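(* Let $X,Y$ be self-adjoint random variables of a non-commutative probability space $(\mathcal{M},\tau)$ with symmetric laws, and assume that $X,Y$ are Boolean independent. Then $$\exp(2\Gamma(X+Y))\ge\exp(2\Gamma(X))+\exp(2\Gamma(Y)).$$ In particular, if $\Gamma(X+Y)=-\infty$, then $\Gamma(X)=\Gamma(Y)=-\infty$.
   Context: A non-commutative probability space $(\mathcal{M},\tau)$ is a von Neumann algebra $\mathcal{M}$ with a nondegenerate normal state $\tau$, not necessarily faithful. For self-adjoint $A\in\mathcal{M}$, the law of $A$ is the unique probability measure $\mu$ on $\mathbb{R}$ with $\tau(A^k)=\int x^k\,d\mu(x)$ for all $k\in\mathbb{N}$. Two self-adjoint $X,Y\in\mathcal{M}$ are Boolean independent if for all finite sequences of integers $k_1,k_2,\ldots\ge 1$, $\tau(X^{k_1}Y^{k_2}X^{k_3}\cdots)=\tau(X^{k_1})\tau(Y^{k_2})\tau(X^{k_3})\cdots$ and $\tau(Y^{k_1}X^{k_2}Y^{k_3}\cdots)=\tau(Y^{k_1})\tau(X^{k_2})\tau(Y^{k_3})\cdots$. For $X$ with law $\mu$, the Boolean entropy is $\Gamma(X)=\int\log|x|\,d\mu(x)\in[-\infty,+\infty)$. Convention: $\exp(-\infty)=0$. *)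

(* Defs.v *)
From HB Require Import structures.
From mathcomp Require Export all_boot all_order all_algebra.
From mathcomp Require Export complex.
From mathcomp Require Export all_classical all_reals all_analysis.
Export numFieldNormedType.Exports.

Set Implicit Arguments.
Unset Strict Implicit.
Unset Printing Implicit Defensive.

Import Order.TTheory GRing.Theory Num.Theory.

Local Open Scope classical_set_scope.
Local Open Scope ring_scope.
Local Open Scope complex_scope.

(* Complex Hilbert spaces are complete normed spaces [H] over [R[i]] with an
   inner product [ip], linear in the first argument, that induces the norm.
   Operators are plain functions [H -> H]: the product is [\o], the unit is
   [idfun], and the power [A^k] is [iter k A]. *)
Section VonNeumannAlgebras.
Context {R : realType} {H : completeNormedModType R[i]}.
Variable ip : {dot H for Num.conj}.

Definition induces_norm : Prop := forall x : H, `|x| ^+ 2 = ip x x.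

Definition bounded_operator (A : H -> H) : Prop := linear A /\ continuous A.

Definition adjoint_of (A B : H -> H) : Prop :=
  forall x y : H, ip (A x) y = ip x (B y).

Definition selfadjoint (A : H -> H) : Prop := adjoint_of A A.

(* Over the complex field, [0 <= <Ax, x>] for all [x] forces a bounded operator
   [A] to be self-adjoint. *)
Definition positive_operator (A : H -> H) : Prop :=
  forall x : H, 0 <= ip (A x) x.

Definition operator_le (A B : H -> H) : Prop :=
  positive_operator (fun x => B x - A x).

Definition commutant (S : set (H -> H)) : set (H -> H) :=
  [set B | bounded_operator B /\ forall A, S A -> A \o B = B \o A].

(* A bicommutant is automatically a unital algebra of bounded operators. *)
Definition von_neumann_algebra (M : set (H -> H)) : Prop :=
  (forall A, M A -> exists2 B, M B & adjoint_of A B) /\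
  commutant (commutant M) = M.

(* Functionals on [M] are total functions on [H -> H], of which only the values
   on [M] matter. *)
Definition state (M : set (H -> H)) (tau : (H -> H) -> R[i]) : Prop :=
  [/\ forall (a : R[i]) A B, M A -> M B ->
        tau (fun x => a *: A x + B x) = a * tau A + tau B,
      forall A, M A -> positive_operator A -> 0 <= tau A
    & tau idfun = 1].

Definition selfadjoint_part (M : set (H -> H)) : set (H -> H) :=
  [set A | M A /\ selfadjoint A].

Definition directed (D : set (H -> H)) : Prop :=
  D !=set0 /\
  forall A B, D A -> D B ->
    exists C, [/\ D C, operator_le A C & operator_le B C].

Definition is_lub_in (E D : set (H -> H)) (S : H -> H) : Prop :=
  [/\ E S,
      forall A, D A -> operator_le A S
    & forall T, E T -> (forall A, D A -> operator_le A T) -> operator_le S T].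

(* [tau] takes real values on self-adjoint elements, so that taking real parts
   loses nothing. *)
Definition normal (M : set (H -> H)) (tau : (H -> H) -> R[i]) : Prop :=
  forall (D : set (H -> H)) (S : H -> H),
    D `<=` selfadjoint_part M -> directed D ->
    is_lub_in (selfadjoint_part M) D S ->
    complex.Re (tau S) = sup [set complex.Re (tau A) | A in D].

(* The usual meaning of nondegeneracy in Boolean probability: the GNS
   representation of [tau] is faithful. *)
Definition nondegenerate_state (M : set (H -> H))
    (tau : (H -> H) -> R[i]) : Prop :=
  forall A, M A ->
    (forall B C, M B -> M C -> tau (B \o A \o C) = 0) -> A = (fun=> 0).

Definition nc_probability_space (M : set (H -> H))
    (tau : (H -> H) -> R[i]) : Prop :=
  [/\ induces_norm, von_neumann_algebra M, state M tau, normal M tau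
    & nondegenerate_state M tau].

End VonNeumannAlgebras.

Section BooleanIndependence.
Context {R : realType} {H : completeNormedModType R[i]}.
Variable tau : (H -> H) -> R[i].

(* [X^k1 Y^k2 X^k3 ...] *)
Fixpoint alternating_product (X Y : H -> H) (ks : seq nat) : H -> H :=
  if ks is k :: ks' then iter k X \o alternating_product Y X ks' else idfun.

(* [tau(X^k1) tau(Y^k2) tau(X^k3) ...] *)
Fixpoint alternating_moments (X Y : H -> H) (ks : seq nat) : R[i] :=
  if ks is k :: ks' then tau (iter k X) * alternating_moments Y X ks' else 1.

Definition boolean_independent (X Y : H -> H) : Prop :=
  forall ks : seq nat, all (leq 1) ks ->
    tau (alternating_product X Y ks) = alternating_moments X Y ks /\
    tau (alternating_product Y X ks) = alternating_moments Y X ks.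

Definition is_law (A : H -> H) (mu : probability (measurableTypeR R) R) : Prop :=
  forall k : nat,
    mu.-integrable setT (fun x : R => (x ^+ k)%:E) /\
    tau (iter k A) = (Rintegral mu setT (fun x : R => x ^+ k))%:C.

End BooleanIndependence.

Definition symmetric_law {R : realType}
    (mu : probability (measurableTypeR R) R) : Prop :=
  forall B : set R, measurable B -> mu (-%R @^-1` B) = mu B.

(* [lne 0 = -oo], whereas the real-valued logarithm has [ln 0 = 0]. *)
Definition boolean_entropy {R : realType}
    (mu : probability (measurableTypeR R) R) : \bar R :=
  \int[mu]_(x in setT) lne (`|x|%:E).

(* Main.v *)
(** Write [N(s) = exp (\int ln (s + x^2) dmu)] and [h(s) = \int (s + x^2)^-1 dmu],
    so that [h = (ln N)'] and [N(0+) = exp (2 Gamma)].  For symmetric laws, Boolean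
    independence says that [1/h - s] is additive: this is an identity between power
    series near infinity, which extends to all [s > 0] because [h] is a power
    series in [1 / (s + L^2)] when [mu] lives on [[-L, L]].  Jensen's inequality
    [N h >= 1] and the bound [s h <= 1] then make
    [(N_X + N_Y - s) / N_{X+Y}] nondecreasing in [s]; its limit at infinity is
    [1], hence [N_X + N_Y - s <= N_{X+Y}], and one lets [s] tend to [0]. *)

From HB Require Import structures.
Require Import Defs.
From mathcomp Require Import measurable_realfun ring lra.

Set Implicit Arguments.
Unset Strict Implicit.
Unset Printing Implicit Defensive.

Import Order.TTheory GRing.Theory Num.Theory.

Local Open Scope classical_set_scope.
Local Open Scope ring_scope.

(** * Von Neumann algebras and moments *)

(** The laws are given only by their moments; boundedness of the operators and positivity of [tau]
    confine them to a segment. Splitting [(X + Y)^n] by first letters yields the functional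
    equation: if [A], [B] generate the words starting with [X], [Y] and [P] generates moments, then
    [A = 1 + (P_X - 1) B], [B = 1 + (P_Y - 1) A] and [P_XY = A + B - 1]. Elimination gives
    [1 / P_XY = 1 / P_X + 1 / P_Y - 1], kept below with denominators cleared. Symmetry makes [P] a
    function of [z ^+ 2], and [s = - 1 / z ^+ 2] turns this into additivity of [1 / h - s]. The
    obstacle is a sign: real [z] reaches only [s < 0], whereas the logarithm needs [s > 0]. The two
    half-lines meet at infinity, that is at [v = 1 / (s + L ^+ 2) = 0], where everything is a real
    power series in [v]. An identity theorem assuming vanishing only for small negative [v] carries
    the equation across without complex variables. Working at [s > 0] also keeps all logarithms
    finite when an entropy is [-oo]. *)

Section VonNeumannMoments.
Local Open Scope complex_scope.
Context {R : realType} {H : completeNormedModType R[i]}.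
Variable ip : {dot H for Num.conj}.
Implicit Types (S M : set (H -> H)) (A B : H -> H).

Lemma commutant_idfun S : commutant S idfun.
Proof. by split=> //; split=> // x; exact: cvg_id. Qed.

Lemma commutant_comp S A B : commutant S A -> commutant S B ->
  commutant S (A \o B).
Proof.
move=> [[lA cA] hA] [[lB cB] hB]; split.
  split; first by move=> a x y /=; rewrite lB lA.
  by move=> x; apply: continuous_comp; [exact: cB | exact: cA].
by move=> C SC; rewrite compA hA// -compA hB.
Qed.

Lemma commutant_linear_comb S (a : R[i]) A B :
  (forall C, S C -> bounded_operator C) -> commutant S A -> commutant S B ->
  commutant S (fun x => a *: A x + B x).
Proof.
move=> bS [[lA cA] hA] [[lB cB] hB]; split.
  split.
    move=> b x y /=; rewrite lA lB !scalerDr !scalerA (mulrC a b).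
    by rewrite addrACA.
  by move=> x; apply: cvgD; [by apply: cvgZ; [exact: cvg_cst | exact: cA] | exact: cB].
move=> C SC; have [lC _] := bS C SC.
apply/funext => x /=; rewrite lC.
by have /(congr1 (fun f => f x)) /= -> := hA C SC;
  have /(congr1 (fun f => f x)) /= -> := hB C SC.
Qed.

Lemma commutant0 S : (forall C, S C -> bounded_operator C) ->
  commutant S (fun=> 0).
Proof.
move=> bS; split.
  split; first by move=> a x y; rewrite scaler0 addr0.
  by move=> x; exact: cvg_cst.
move=> C SC; have [lC _] := bS C SC; apply/funext => x /=.
by have := lC (-1) 0 0; rewrite scaler0 addr0 scaleN1r addNr.
Qed.

Section Algebra.
Variables (M : set (H -> H)).
Hypothesis HM : commutant (commutant M) = M.

Lemma vn_bounded A : M A -> bounded_operator A.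
Proof. by rewrite -{1}HM => -[]. Qed.

Lemma vn_idfun : M idfun.
Proof. by rewrite -HM; exact: commutant_idfun. Qed.

Lemma vn_comp A B : M A -> M B -> M (A \o B).
Proof. by rewrite -HM; exact: commutant_comp. Qed.

Lemma vn_linear_comb (a : R[i]) A B : M A -> M B ->
  M (fun x => a *: A x + B x).
Proof. by rewrite -HM; apply: commutant_linear_comb => C []. Qed.

Lemma vn0 : M (fun=> 0).
Proof. by rewrite -HM; apply: commutant0 => C []. Qed.

Lemma vn_add A B : M A -> M B -> M (fun x => A x + B x).
Proof.
move=> MA MB; have := vn_linear_comb 1 MA MB.
by congr M; apply/funext => x; rewrite scale1r.
Qed.

Lemma vn_iter A k : M A -> M (iter k A).
Proof.
by move=> MA; elim: k => [|k IH]; [exact: vn_idfun | exact: (vn_comp MA IH)].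
Qed.

Variable tau : (H -> H) -> R[i].
Hypothesis st : state ip M tau.

Lemma state0 : tau (fun=> 0) = 0.
Proof.
have [lt _ _] := st; have := lt 1 _ _ vn0 vn0.
rewrite (_ : (fun x => _) = (fun=> 0 : H)); last first.
  by apply/funext => x; rewrite scaler0 addr0.
by rewrite mul1r => /eqP; rewrite -subr_eq0 opprD addrA subrr sub0r oppr_eq0 => /eqP.
Qed.

Lemma stateD A B : M A -> M B -> tau (fun x => A x + B x) = tau A + tau B.
Proof.
move=> MA MB; have [lt _ _] := st; have := lt 1 _ _ MA MB.
by rewrite mul1r => <-; congr tau; apply/funext => x; rewrite scale1r.
Qed.

End Algebra.

Lemma bounded_operator_ge0 A : bounded_operator A ->
  exists2 L : R, 0 <= L & forall x, `|A x| <= L%:C * `|x|.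
Proof.
move=> [lA cA].
pose fm := GRing.isLinear.Build R[i] H H *:%R A lA.
pose f : {linear H -> H} := HB.pack A fm.
have cf : continuous f by [].
have /linear_bounded_continuous/linear_boundedP/pinfty_ex_gt0[r r0 hr] := cf.
have er : (complex.Re r)%:C = r by rewrite RRe_real// gtr0_real.
exists (complex.Re r); first by rewrite -ler0c er ltW.
by rewrite er; exact: hr.
Qed.

Lemma selfadjoint_iter A k : selfadjoint ip A -> selfadjoint ip (iter k A).
Proof.
move=> sA; elim: k => [|k IH] x y //.
by rewrite iterS sA IH -iterSr.
Qed.

(** Self-adjointness gives [<A^(2k) x, x> = |A^k x|^2 <= L^(2k) |x|^2], so [L^(2k) - A^(2k)] is a
    positive operator, on which [tau] is nonnegative. These bounds will confine the law to a
    segment. *)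
Lemma even_moment_le (M : set (H -> H)) tau A
  (HM : nc_probability_space ip M tau) (mu : probability (measurableTypeR R) R) :
  M A -> selfadjoint ip A -> is_law tau A mu ->
  exists2 L : R, 0 <= L &
    forall k, \int[mu]_x (x ^+ (k + k)) <= L ^+ (k + k).
Proof.
move=> MA sA lawA; case: HM => normip [_ vnM] st _ _.
have [L L0 hL] := bounded_operator_ge0 (vn_bounded vnM MA).
exists L => // k.
have hLk x : `|iter k A x| <= (L ^+ k)%:C * `|x|.
  elim: k x => [|k IH] x; first by rewrite expr0 mul1r.
  rewrite iterS; apply: le_trans (hL _) _.
  by rewrite exprS rmorphM -mulrA ler_wpM2l// ler0c.
have [lt pt t1] := st.
(* [L ^+ (k + k)] times the identity, in the shape [a *: A x + B x] for which [state] states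
   linearity. *)
pose B := fun x : H => (L ^+ (k + k))%:C *: idfun x + (fun=> 0) x.
have MB : M B by apply: (vn_linear_comb vnM) => //; [exact: vn_idfun|exact: vn0].
have MAk := vn_iter vnM (k + k) MA.
have tB : tau B = (L ^+ (k + k))%:C.
  rewrite lt ?t1 ?(state0 vnM st) ?mulr1 ?addr0//; [exact: vn_idfun|exact: vn0].
have : 0 <= tau (fun x => -1 *: iter (k + k) A x + B x).
  apply: pt; first exact: (vn_linear_comb vnM).
  move=> x; rewrite linearDl /= scaleN1r linearNl /B /= addr0 linearZl_LR /=.
  rewrite iterD (selfadjoint_iter k sA) addrC subr_ge0 -!normip.
  rewrite exprD rmorphM -expr2 -exprMn; apply: lerXn2r; rewrite ?nnegrE//.
  by rewrite mulr_ge0// ler0c exprn_ge0.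
rewrite lt// tB mulN1r addrC subr_ge0.
by have [_ ->] := lawA (k + k)%N; rewrite lecR.
Qed.

End VonNeumannMoments.

(** * Boolean independence and words *)

Section BooleanWords.
Local Open Scope complex_scope.
Context {R : realType} {H : completeNormedModType R[i]}.
Variables (ip : {dot H for Num.conj}) (M : set (H -> H)).
Variable tau : (H -> H) -> R[i].
Hypotheses (vnM : commutant (commutant M) = M) (st : state ip M tau).
Variables X Y : H -> H.
Hypotheses (MX : M X) (MY : M Y) (indep : boolean_independent tau X Y).

Let Z (b : bool) := if b then X else Y.
Let T := fun x => X x + Y x.

Let MZ b : M (Z b). Proof. by case: b. Qed.

Let MT : M T. Proof. exact: vn_add. Qed.

(* The part of [(X + Y)^n] made of the words whose first letter is [Z b]. *)
Definition first_letter_word (b : bool) (n : nat) : H -> H :=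
  if n is n'.+1 then Z b \o iter n' T else idfun.
Local Notation W := first_letter_word.

Lemma vn_word b n : M (W b n).
Proof.
case: n => [|n]; first exact: vn_idfun.
by apply: vn_comp => //; exact: vn_iter.
Qed.

Lemma vn_linear A : M A -> linear A.
Proof. by case/(vn_bounded vnM). Qed.

Lemma vn_apply_sum A n (F : 'I_n -> H) :
  M A -> A (\sum_(i < n) F i) = \sum_(i < n) A (F i).
Proof.
move=> MA; have lA := vn_linear MA.
have A0 : A 0 = 0 by have := lA (-1) 0 0; rewrite scaler0 addr0 scaleN1r addNr.
elim: n F => [|n IH] F; first by rewrite !big_ord0.
rewrite !big_ord_recr /= -IH.
by have := lA 1 (\sum_(i < n) F (widen_ord (leqnSn n) i)) (F ord_max); rewrite !scale1r.
Qed.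

Lemma state_sum n (F : 'I_n -> H -> H) : (forall i, M (F i)) ->
  M (fun x => \sum_(i < n) F i x) /\
  tau (fun x => \sum_(i < n) F i x) = \sum_(i < n) tau (F i).
Proof.
elim: n F => [|n IH] F MF.
  rewrite big_ord0 (_ : (fun x => _) = (fun=> 0)); last first.
    by apply/funext => x; rewrite big_ord0.
  by split; [exact: vn0 | exact: (state0 vnM st)].
have [M1 t1] := IH (fun i => F (widen_ord (leqnSn n) i)) (fun i => MF _).
rewrite (_ : (fun x => _) =
    (fun x => (\sum_(i < n) F (widen_ord (leqnSn n) i) x) + F ord_max x)); last first.
  by apply/funext => x; rewrite big_ord_recr.
split; first exact: vn_add.
by rewrite (stateD st)// t1 big_ord_recr.
Qed.

(** Words are sorted by the length [k.+1] of their initial run of [Z b]. The rest starts with the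
    other letter or is empty; the empty rest occurs once, at [k = n], since [W _ 0] is the
    identity. *)
Lemma wordS b n x :
  W b n.+1 x = \sum_(k < n.+1) iter k.+1 (Z b) (W (~~ b) (n - k) x).
Proof.
elim: n => [|n IH]; first by rewrite big_ord_recl big_ord0 addr0.
have lZ := vn_linear (MZ b).
have -> : W b n.+2 x = Z b (W (~~ b) n.+1 x) + Z b (W b n.+1 x).
  have -> : W b n.+2 x = Z b (T (iter n T x)) by [].
  have := lZ 1 (W (~~ b) n.+1 x) (W b n.+1 x).
  rewrite !scale1r => <-; congr (Z b _).
  by rewrite /T /=; case: (b) => //=; rewrite addrC.
rewrite [in LHS]IH (vn_apply_sum _ (MZ b)) [in RHS]big_ord_recl subn0; congr (_ + _).
Qed.

(** The letters alternate from [Z c], so parity of the length decides which one an appended power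
    belongs to. *)
Lemma alternating_product_rcons c ks k :
  alternating_product (Z c) (Z (~~ c)) (rcons ks k) =
  alternating_product (Z c) (Z (~~ c)) ks \o iter k (Z (c (+) odd (size ks))).
Proof.
elim: ks c => [|j ks IH] c /=; first by rewrite addbF.
have := IH (~~ c); rewrite negbK => ->.
by rewrite compA addNb addbN.
Qed.

Lemma alternating_moments_rcons c ks k :
  alternating_moments tau (Z c) (Z (~~ c)) (rcons ks k) =
  alternating_moments tau (Z c) (Z (~~ c)) ks *
    tau (iter k (Z (c (+) odd (size ks)))).
Proof.
elim: ks c => [|j ks IH] c /=; first by rewrite addbF mulr1 mul1r.
have := IH (~~ c); rewrite negbK => ->.
by rewrite mulrA addNb addbN.
Qed.

Lemma vn_alternating_product c ks :
  M (alternating_product (Z c) (Z (~~ c)) ks).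
Proof.
elim: ks c => [|k ks IH] c /=; first exact: vn_idfun.
apply: vn_comp => //; first exact: vn_iter.
by have := IH (~~ c); rewrite negbK.
Qed.

(** Independence speaks of alternating powers only, while here the last factor is a whole sum of
    words. The induction on [n] treats all prefixes at once: peeling the first run off the word
    appends a block to [ks] and leaves a shorter word starting with the other letter. *)
Lemma state_alternating_word n c ks : all (leq 1) ks ->
  tau (alternating_product (Z c) (Z (~~ c)) ks \o W (c (+) odd (size ks)) n) =
  alternating_moments tau (Z c) (Z (~~ c)) ks * tau (W (c (+) odd (size ks)) n).
Proof.
elim/ltn_ind: n c ks => -[|n] IH c ks hks.
  have [_ _ t1] := st; rewrite /= t1 mulr1.
  by have [h1 h2] := indep hks; case: c; [exact: h1 | exact: h2].
set b := c (+) odd (size ks).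
set P := alternating_product _ _ _.
have MP : M P by exact: vn_alternating_product.
have MF (k : 'I_n.+1) : M (iter k.+1 (Z b) \o W (~~ b) (n - k)).
  by apply: vn_comp => //; [exact: vn_iter | exact: vn_word].
have eW : W b n.+1 =
    (fun x => \sum_(k < n.+1) (iter k.+1 (Z b) \o W (~~ b) (n - k)) x).
  by apply/funext => x; rewrite wordS.
(* Taking the run alone as prefix evaluates the right-hand side. *)
have tW (k : 'I_n.+1) : tau (iter k.+1 (Z b) \o W (~~ b) (n - k)) =
    tau (iter k.+1 (Z b)) * tau (W (~~ b) (n - k)).
  have := IH (n - k)%N _ b [:: k.+1] isT; rewrite /= mulr1 addbT; apply.
  by rewrite ltnS leq_subr.
rewrite eW (proj2 (state_sum MF)) mulr_sumr.
rewrite (_ : P \o _ = (fun x =>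
    \sum_(k < n.+1) (P \o (iter k.+1 (Z b) \o W (~~ b) (n - k))) x)); last first.
  by apply/funext => x; rewrite /= vn_apply_sum.
rewrite (proj2 (state_sum _)); last by move=> k; exact: (vn_comp vnM MP (MF k)).
apply: eq_bigr => k _; rewrite tW mulrA.
(* The same hypothesis, now with the run appended to [ks], evaluates the left-hand side. *)
have := IH (n - k)%N _ c (rcons ks k.+1).
rewrite alternating_product_rcons alternating_moments_rcons -/b -/P compA.
rewrite size_rcons /= addbN -/b; apply; first by rewrite ltnS leq_subr.
by rewrite all_rcons.
Qed.

Lemma state_wordS b n : tau (W b n.+1) =
  \sum_(k < n.+1) tau (iter k.+1 (Z b)) * tau (W (~~ b) (n - k)).
Proof.
have MF (k : 'I_n.+1) : M (iter k.+1 (Z b) \o W (~~ b) (n - k)).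
  by apply: vn_comp => //; [exact: vn_iter | exact: vn_word].
rewrite (_ : W b n.+1 =
    (fun x => \sum_(k < n.+1) (iter k.+1 (Z b) \o W (~~ b) (n - k)) x)); last first.
  by apply/funext => x; rewrite wordS.
rewrite (proj2 (state_sum MF)); apply: eq_bigr => k _.
by have := @state_alternating_word (n - k) b [:: k.+1] isT; rewrite /= mulr1 addbT.
Qed.

(** The witnesses are the real parts of [tau] on the words starting with [X] and with [Y]. Real
    parts pass through the products because one factor, a moment, is real. The empty word is counted
    in both sequences, so the last identity starts at exponent one. *)
Lemma boolean_sum_moments (muX muY muXY : probability (measurableTypeR R) R) :
  is_law tau X muX -> is_law tau Y muY -> is_law tau T muXY ->
  exists a b : nat -> R, [/\ a 0%N = 1 /\ b 0%N = 1,
    forall n, a n.+1 = \sum_(k < n.+1) (\int[muX]_x (x ^+ k.+1)) * b (n - k)%N,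
    forall n, b n.+1 = \sum_(k < n.+1) (\int[muY]_x (x ^+ k.+1)) * a (n - k)%N &
    forall n, \int[muXY]_x (x ^+ n.+1) = a n.+1 + b n.+1].
Proof.
move=> lX lY lT.
have [_ _ t1] := st.
have ReZ (r : R) (z : R[i]) : complex.Re (r%:C * z) = r * complex.Re z.
  by case: z => u v /=; rewrite mul0r subr0.
have ReD (y z : R[i]) : complex.Re (y + z) = complex.Re y + complex.Re z.
  by case: y; case: z.
have ReS n (F : 'I_n -> R[i]) :
    complex.Re (\sum_(i < n) F i) = \sum_(i < n) complex.Re (F i).
  elim: n F => [|n IH] F; first by rewrite !big_ord0.
  by rewrite !big_ord_recr/= ReD IH.
exists (fun n => complex.Re (tau (W true n))), (fun n => complex.Re (tau (W false n))).
split.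
- by rewrite /= t1.
- move=> n; rewrite state_wordS ReS; apply: eq_bigr => k _.
  by rewrite (proj2 (lX k.+1)) ReZ.
- move=> n; rewrite state_wordS ReS; apply: eq_bigr => k _.
  by rewrite (proj2 (lY k.+1)) ReZ.
- move=> n; have := proj2 (lT n.+1).
  rewrite (_ : iter n.+1 T = (fun x => W true n.+1 x + W false n.+1 x))//.
  rewrite (stateD st); [|exact: vn_word|exact: vn_word].
  by rewrite -ReD => ->.
Qed.

End BooleanWords.

(** * Power series *)

Section PowerSeries.
Context {R : realType}.
Implicit Types (a b c : nat -> R) (f g : R -> R) (rho q v : R).

Definition conv a b (n : nat) : R := \sum_(i < n.+1) a i * b (n - i)%N.

(** Radius of convergence at least [rho], in the form of Cauchy estimates: no limsup is involved,
    and a product only costs a passage to a slightly larger [q]. *)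
Definition coef_bounded rho a : Prop :=
  forall q, 0 <= q < rho -> exists2 M, 0 <= M & forall n, `|a n| * q ^+ n <= M.

Definition has_psum rho a f : Prop :=
  coef_bounded rho a /\
  forall v, `|v| < rho -> series (fun n => a n * v ^+ n) @ \oo --> f v.

Lemma geometric_sum_le (q : R) (n : nat) :
  0 <= q < 1 -> \sum_(i < n) q ^+ i <= (1 - q)^-1.
Proof.
move=> /andP[q0 q1].
have d0 : 0 < 1 - q by rewrite subr_gt0.
rewrite -(ler_pM2l d0) divff ?gt_eqF//.
have := subrX1 q n => h.
have qn := exprn_ge0 n q0.
have -> : (1 - q) * \sum_(i < n) q ^+ i = 1 - q ^+ n.
  by rewrite -(opprB q 1) mulNr -h opprB.
by rewrite gerBl.
Qed.

(** Each of the [n.+1] terms [q ^+ i] with [i <= n] is at least [q ^+ n]. *)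
Lemma linear_geometric_le (q : R) (n : nat) :
  0 <= q < 1 -> n.+1%:R * q ^+ n <= (1 - q)^-1.
Proof.
move=> qq; apply: le_trans (geometric_sum_le n.+1 qq).
case/andP: qq => q0 q1.
rewrite mulr_natl -[in leLHS](card_ord n.+1) -sumr_const.
apply: ler_sum => i _; apply: ler_wiXn2l => //; first exact: ltW.
by rewrite -ltnS.
Qed.

Lemma conv_bound a b (M q : R) n : 0 <= q -> 0 <= M ->
  (forall n, `|a n| * q ^+ n <= M) -> (forall n, `|b n| * q ^+ n <= M) ->
  `|conv a b n| * q ^+ n <= n.+1%:R * M ^+ 2.
Proof.
move=> q0 M0 ha hb.
rewrite -{1}(ger0_norm (exprn_ge0 n q0)) -normrM /conv mulr_suml.
apply: le_trans (ler_norm_sum _ _ _) _.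
rewrite mulr_natl -[in leRHS](card_ord n.+1) -sumr_const.
apply: ler_sum => i _; rewrite !normrM (ger0_norm (exprn_ge0 n q0)).
have -> : q ^+ n = q ^+ i * q ^+ (n - i).
  by rewrite -exprD subnKC// -ltnS.
rewrite mulrACA expr2; apply: ler_pM; rewrite ?mulr_ge0 ?exprn_ge0//.
Qed.

Lemma coef_bounded_conv rho a b :
  coef_bounded rho a -> coef_bounded rho b -> coef_bounded rho (conv a b).
Proof.
move=> ha hb q /andP[q0 qr].
(* Convolution costs a factor [n.+1], which [(q / p) ^+ n] absorbs for an intermediate radius
   [p]. *)
pose p := (q + rho) / 2.
have [qp pr] : q < p /\ p < rho by rewrite /p; split; lra.
have p0 : 0 < p by lra.
have [|M1 M10 h1] := ha p; first by rewrite ltW.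
have [|M2 M20 h2] := hb p; first by rewrite ltW.
pose M := Num.max M1 M2.
have M0 : 0 <= M by rewrite le_max M10.
have t01 : 0 <= q / p < 1 by rewrite divr_ge0 ?(ltW p0)//= ltr_pdivrMr// mul1r.
exists ((1 - q / p)^-1 * M ^+ 2).
  by rewrite mulr_ge0 ?exprn_ge0// invr_ge0 subr_ge0; case/andP: t01 => _ /ltW.
move=> n.
have -> : q ^+ n = p ^+ n * (q / p) ^+ n.
  by rewrite -exprMn mulrCA divff ?mulr1// gt_eqF.
rewrite mulrA.
apply: (@le_trans _ _ (n.+1%:R * M ^+ 2 * (q / p) ^+ n)).
  apply: ler_wpM2r; first by apply: exprn_ge0; case/andP: t01.
  apply: conv_bound => //; first exact: ltW.
    by move=> k; rewrite (le_trans (h1 k))// le_max lexx.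
  by move=> k; rewrite (le_trans (h2 k))// le_max lexx orbT.
rewrite mulrAC; apply: ler_wpM2r; first exact: exprn_ge0.
exact: linear_geometric_le.
Qed.

Lemma cvg_geo_bounded (u : nat -> R) (l C q : R) : 0 <= q < 1 ->
  (forall n, `|l - u n| <= C * q ^+ n) -> u @ \oo --> l.
Proof.
move=> /andP[q0 q1] h.
apply/cvgrPdist_le => /= e e0.
have h0 : (fun n => C * q ^+ n) @ \oo --> (0 : R).
  by apply: cvg_geometric; rewrite ger0_norm.
move/cvgrPdist_le : h0 => /(_ e e0); apply: filterS => n.
rewrite sub0r normrN => hn; apply: le_trans (h n) _.
exact: le_trans (ler_norm _) hn.
Qed.

Lemma coef_bounded_at rho a v : coef_bounded rho a -> `|v| < rho ->
  exists M q, [/\ 0 <= M, 0 <= q < 1 & forall n, `|a n * v ^+ n| <= M * q ^+ n].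
Proof.
move=> ha vr.
pose p := (`|v| + rho) / 2.
have v0 := normr_ge0 v.
have [qp pr] : `|v| < p /\ p < rho by rewrite /p; split; lra.
have p0 : 0 < p by lra.
have [|M M0 h1] := ha p; first by rewrite ltW.
exists M, (`|v| / p); split => //.
  by rewrite divr_ge0 ?(ltW p0)//= ltr_pdivrMr// mul1r.
move=> n; rewrite normrM normrX.
have -> : `|v| ^+ n = p ^+ n * (`|v| / p) ^+ n.
  by rewrite -exprMn mulrCA divff ?mulr1// gt_eqF.
rewrite mulrA; apply: ler_wpM2r => //.
by rewrite exprn_ge0// divr_ge0// ltW.
Qed.

Lemma conv_mulX a b v n :
  conv (fun k => a k * v ^+ k) (fun k => b k * v ^+ k) n = conv a b n * v ^+ n.
Proof.
rewrite /conv mulr_suml; apply: eq_bigr => i _.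
have -> : v ^+ n = v ^+ i * v ^+ (n - i) by rewrite -exprD subnKC// -ltnS.
by rewrite mulrACA.
Qed.

(** The truncations are values at [1] of polynomials whose product has the coefficients of
    [conv a b] below degree [N]. The degrees from [N] on remain, each a sum of [(N + i).+1]
    products. *)
Lemma series_conv_bound a b (M q : R) (N : nat) : 0 <= M -> 0 <= q < 1 ->
  (forall n, `|a n| <= M * q ^+ n) -> (forall n, `|b n| <= M * q ^+ n) ->
  `|series a N * series b N - series (conv a b) N|
    <= \sum_(i < N) M ^+ 2 * (N + i).+1%:R * q ^+ (N + i).
Proof.
move=> M0 /andP[q0 q1] ha hb.
pose pa := \poly_(i < N) a i; pose pb := \poly_(i < N) b i.
have ea : series a N = pa.[1].
  rewrite (horner_coef_wide _ (size_poly _ _)) seriesEord /=.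
  by apply: eq_bigr => i _; rewrite expr1n mulr1 coef_poly ltn_ord.
have eb : series b N = pb.[1].
  rewrite (horner_coef_wide _ (size_poly _ _)) seriesEord /=.
  by apply: eq_bigr => i _; rewrite expr1n mulr1 coef_poly ltn_ord.
have sp : (size (pa * pb)%R <= N + N)%N.
  apply: leq_trans (size_polyMleq _ _) _.
  by rewrite (leq_trans (leq_pred _))// leq_add// size_poly.
rewrite ea eb -hornerM (horner_coef_wide _ sp) big_split_ord /=.
rewrite [X in X + _ - _](_ : _ = series (conv a b) N); last first.
  rewrite seriesEord /=; apply: eq_bigr => i _; rewrite expr1n mulr1 coefM /conv.
  apply: eq_bigr => j _; rewrite !coef_poly.
  have iN := ltn_ord i; have ji := ltn_ord j.
  by rewrite (leq_ltn_trans _ iN) ?(leq_ltn_trans (leq_subr _ _) iN)// -ltnS.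
rewrite addrAC subrr add0r.
apply: le_trans (ler_norm_sum _ _ _) _; apply: ler_sum => i _.
rewrite expr1n mulr1 coefM; apply: le_trans (ler_norm_sum _ _ _) _.
rewrite mulrAC mulr_natr -[X in _ *+ X](card_ord (N + i).+1) -sumr_const.
apply: ler_sum => j _.
have -> : q ^+ (N + i) = q ^+ j * q ^+ (N + i - j).
  by rewrite -exprD subnKC// -ltnS.
rewrite normrM expr2 mulrACA; apply: ler_pM => //; rewrite coef_poly;
  by case: ifP => _ //; rewrite normr0 mulr_ge0// exprn_ge0.
Qed.

Lemma cauchy_product a b (A B M q : R) : 0 <= M -> 0 <= q < 1 ->
  (forall n, `|a n| <= M * q ^+ n) -> (forall n, `|b n| <= M * q ^+ n) ->
  series a @ \oo --> A -> series b @ \oo --> B ->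
  series (conv a b) @ \oo --> A * B.
Proof.
move=> M0 /andP[q0 q1] ha hb cA cB.
(* A ratio strictly between [q] and [1] absorbs the linear factor of the error. *)
pose r := (q + 1) / 2.
have [qr r1] : q < r /\ r < 1 by rewrite /r; split; lra.
have r0 : 0 < r by lra.
have qr01 : 0 <= q / r < 1 by rewrite divr_ge0 ?(ltW r0)//= ltr_pdivrMr// mul1r.
pose C := (1 - q / r)^-1.
have C0 : 0 <= C by rewrite invr_ge0 subr_ge0; case/andP: qr01 => _ /ltW.
have d0 : (fun N => series a N * series b N - series (conv a b) N) @ \oo --> (0 : R).
  apply: (@cvg_geo_bounded _ _ (M ^+ 2 * C * (1 - r)^-1) r).
    by rewrite (ltW r0).
  move=> N; rewrite sub0r normrN.
  apply: le_trans (series_conv_bound N M0 _ ha hb) _; first by rewrite q0.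
  have hq n : n.+1%:R * q ^+ n <= C * r ^+ n.
    have -> : q ^+ n = (q / r) ^+ n * r ^+ n by rewrite -exprMn divfK// gt_eqF.
    rewrite mulrA; apply: ler_wpM2r; first by rewrite exprn_ge0// ltW.
    exact: linear_geometric_le.
  apply: (@le_trans _ _ (\sum_(i < N) M ^+ 2 * C * r ^+ N * r ^+ i)).
    apply: ler_sum => i _; rewrite -!mulrA; apply: ler_wpM2l => //.
    by apply: ler_wpM2l => //; rewrite -exprD.
  rewrite -mulr_sumr mulrAC; apply: ler_wpM2r; first by rewrite exprn_ge0// ltW.
  apply: ler_wpM2l; first by rewrite mulr_ge0// exprn_ge0.
  by apply: geometric_sum_le; rewrite r1 ltW.
have -> : series (conv a b) =
    (fun N => series a N * series b N - (series a N * series b N - series (conv a b) N)).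
  by apply/funext => N; rewrite opprB addrCA subrr addr0.
rewrite -[A * B]subr0; apply: cvgB => //; exact: cvgM.
Qed.

Lemma has_psumM rho a b f g : has_psum rho a f -> has_psum rho b g ->
  has_psum rho (conv a b) (fun v => f v * g v).
Proof.
move=> [ha sa] [hb sb]; split; first exact: coef_bounded_conv.
move=> v vr.
have [M1 [q1 [M10 /andP[q10 q11] h1]]] := coef_bounded_at ha vr.
have [M2 [q2 [M20 /andP[q20 q21] h2]]] := coef_bounded_at hb vr.
under [X in series X]funext do rewrite -conv_mulX.
have le1 n : M1 * q1 ^+ n <= Num.max M1 M2 * Num.max q1 q2 ^+ n.
  by apply: ler_pM; rewrite ?exprn_ge0 ?lerXn2r ?nnegrE ?le_max ?lexx ?q10.
have le2 n : M2 * q2 ^+ n <= Num.max M1 M2 * Num.max q1 q2 ^+ n.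
  by apply: ler_pM; rewrite ?exprn_ge0 ?lerXn2r ?nnegrE ?le_max ?lexx ?q20 ?orbT.
apply: (@cauchy_product _ _ _ _ (Num.max M1 M2) (Num.max q1 q2)).
- by rewrite le_max M10.
- by rewrite le_max q10 gt_max q11.
- by move=> n; apply: le_trans (h1 n) (le1 n).
- by move=> n; apply: le_trans (h2 n) (le2 n).
- exact: sa.
- exact: sb.
Qed.

Lemma has_psumD rho a b f g : has_psum rho a f -> has_psum rho b g ->
  has_psum rho (fun n => a n + b n) (fun v => f v + g v).
Proof.
move=> [ha sa] [hb sb]; split.
  move=> q qr; have [M1 M10 h1] := ha q qr; have [M2 M20 h2] := hb q qr.
  exists (M1 + M2); first exact: addr_ge0.
  move=> n; apply: le_trans (lerD (h1 n) (h2 n)).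
  rewrite -mulrDl; apply: ler_wpM2r; last exact: ler_normD.
  by rewrite exprn_ge0//; case/andP: qr.
move=> v vr.
rewrite (_ : series _ = series (fun n => a n * v ^+ n) + series (fun n => b n * v ^+ n)).
  by apply: cvgD; [exact: sa | exact: sb].
by rewrite -seriesD; congr series; apply/funext => n; rewrite /= mulrDl.
Qed.

Lemma has_psum_poly rho (p : {poly R}) : has_psum rho (nth 0 p) (horner p).
Proof.
split=> [q /andP[q0 _]|v _].
  exists (\sum_(i < size p) `|p`_i| * q ^+ i) => [|n].
    by apply: sumr_ge0 => i _; rewrite mulr_ge0// exprn_ge0.
  have [np|np] := ltnP n (size p); last first.
    rewrite nth_default// normr0 mul0r; apply: sumr_ge0 => i _.
    by rewrite mulr_ge0// exprn_ge0.
  rewrite (bigD1 (Ordinal np))//= lerDl; apply: sumr_ge0 => i _.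
  by rewrite mulr_ge0// exprn_ge0.
apply: (@cvg_near_cst _ _ _ _ _); exists (size p) => // n /= np.
by rewrite seriesEord/= (horner_coef_wide _ np).
Qed.

Lemma coef_bounded_has_psum rho a :
  coef_bounded rho a -> exists f, has_psum rho a f.
Proof.
move=> ha; exists (fun v => limn (series (fun n => a n * v ^+ n))).
split=> // v vr; apply: normed_cvg.
have [M [q [M0 /andP[q0 q1] h]]] := coef_bounded_at ha vr.
apply: (@series_le_cvg _ _ (geometric M q)) => //.
- by move=> n; exact: normr_ge0.
- by move=> n; rewrite /geometric/= mulr_ge0// exprn_ge0.
- by apply: is_cvg_geometric_series; rewrite ger0_norm.
Qed.

(** One-sided identity theorem. If the coefficients below [m] vanish, then [f (- t) = 0] says that
    [a m * (- t) ^+ m] is cancelled by a tail of order [t ^+ m.+1]; letting [t] tend to [0] forces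
    [a m = 0]. *)
Lemma has_psum_eq0 rho a f (e : R) : 0 < e -> has_psum rho a f ->
  (forall v, - e < v < 0 -> f v = 0) -> forall v, `|v| < rho -> f v = 0.
Proof.
move=> e0 [ha sa] f0.
suff a0 n : 0 < rho -> a n = 0.
  move=> v vr; have rho0 : 0 < rho by apply: le_lt_trans vr.
  have := sa v vr; move/cvg_lim => <- //.
  rewrite (_ : series _ = cst 0) ?lim_cst//; apply/funext => N.
  by rewrite seriesEord /= big1// => i _; rewrite a0// mul0r.
move=> rho0; elim/ltn_ind : n => m IH.
have [M M0 hM] : exists2 M, 0 <= M & forall n, `|a n| * (rho / 2) ^+ n <= M.
  by apply: ha; lra.
apply/eqP; rewrite -normr_le0; apply/ler_addgt0Pl => d' d'0; rewrite addr0.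
(* One half of [d'] pays for truncating the series, the other for the tail. *)
pose d := d' / 2.
have d0 : 0 < d by rewrite divr_gt0.
pose h := rho / 2.
have h0 : 0 < h by rewrite /h; lra.
(* Since [|a n| <= M / h ^+ n], for [t <= h / 2] the terms beyond [m] are dominated by a geometric
   series of ratio [1 / 2], with sum at most [C * t ^+ m.+1]. *)
pose C := M / h ^+ m.+1 * 2.
have C0 : 0 <= C.
  by rewrite /C !mulr_ge0// invr_ge0 exprn_ge0// ltW.
(* In order: [f] vanishes at [- t], the ratio is at most [1 / 2], the tail is at most [d * t ^+ m].
   The [+ 1] guards against [C = 0]. *)
pose t := Num.min (Num.min (e / 2) (h / 2)) (d / (C + 1)).
have t0 : 0 < t by rewrite !lt_min !divr_gt0//= ltr_wpDl.
have te : t < e.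
  have : t <= e / 2 by rewrite !ge_min lexx.
  by move=> te; lra.
have th : t <= h / 2 by rewrite !ge_min lexx orbT.
have tC : C * t <= d.
  have tC : t <= d / (C + 1) by rewrite !ge_min lexx !orbT.
  have : t * (C + 1) <= d by rewrite -ler_pdivlMr// ltr_wpDl.
  by rewrite mulrDr mulr1 mulrC; move: t0; lra.
have tv : `|- t| < rho by rewrite normrN gtr0_norm//; move: th; rewrite /h; lra.
have fv : f (- t) = 0 by apply: f0; rewrite ltrN2 te oppr_lt0.
have := sa _ tv; rewrite fv => /cvgrPdist_le /(_ (d * t ^+ m)).
rewrite mulr_gt0 ?exprn_gt0// => /(_ isT)[N _ hN].
have := hN (N + m.+1)%N (leq_addr _ _).
rewrite /= sub0r normrN seriesEord/= addnC big_split_ord big_ord_recr/=.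
rewrite big1 ?add0r; last by move=> i _; rewrite IH ?ltn_ord// mul0r.
set S := (X in _ + X).
have hS : `|S| <= C * t * t ^+ m.
  apply: le_trans (ler_norm_sum _ _ _) _.
  apply: (@le_trans _ _ (\sum_(i < N) (M * (t / h) ^+ m.+1) * (2^-1) ^+ i)).
    apply: ler_sum => i _; rewrite normrM normrX normrN (gtr0_norm t0).
    have hti : t ^+ (m.+1 + i) = h ^+ (m.+1 + i) * (t / h) ^+ (m.+1 + i).
      by rewrite -exprMn mulrCA divff ?mulr1// gt_eqF.
    have thh : 0 <= t / h by rewrite divr_ge0// ltW.
    rewrite hti mulrA -[in leRHS]mulrA; apply: ler_pM.
    - by rewrite mulr_ge0// exprn_ge0// ltW.
    - by rewrite exprn_ge0.
    - exact: hM.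
    - rewrite exprD; apply: ler_wpM2l; first exact: exprn_ge0.
      have tt : t / h <= 2^-1 by rewrite ler_pdivrMr// mulrC.
      by apply: lerXn2r; rewrite ?nnegrE// invr_ge0.
  rewrite -mulr_sumr.
  have g : \sum_(i < N) (2^-1 : R) ^+ i <= 2.
    have := @geometric_sum_le 2^-1 N; have -> : (1 - 2^-1 : R)^-1 = 2 by field.
    by apply; lra.
  apply: le_trans (ler_wpM2l _ g) _.
    by rewrite mulr_ge0// exprn_ge0// divr_ge0// ltW.
  rewrite expr_div_n [t ^+ m.+1]exprS.
  suff -> : M * (t * t ^+ m / h ^+ m.+1) * 2 = C * t * t ^+ m by [].
  by rewrite /C; ring.
move=> hm.
have : `|a m * (- t) ^+ m| <= d * t ^+ m + C * t * t ^+ m.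
  by rewrite -[X in `|X|](addrK S); apply: le_trans (ler_normB _ _) (lerD hm hS).
rewrite normrM normrX normrN (gtr0_norm t0) -mulrDl ler_pM2r ?exprn_gt0// => hh.
by apply: le_trans hh _; rewrite /d in tC *; lra.
Qed.
End PowerSeries.

(** * Measures on a segment *)

Section BoundedSupport.
Context {R : realType}.
Implicit Types (mu : probability (measurableTypeR R) R) (L s v K : R).
Implicit Types f g : R -> R.

Definition supported_in mu L : Prop := mu (~` `[- L, L]%classic) = 0%E.

Lemma sqr_le_segment L (x : R) : `[- L, L]%classic x -> x ^+ 2 <= L ^+ 2.
Proof.
rewrite /= in_itv /= -ler_norml => xL.
by rewrite -real_normK ?num_real// lerXn2r ?nnegrE// (le_trans _ xL).
Qed.

(** Chebyshev's inequality for [x ^+ (k + k)] bounds the mass outside by [(L / (L + 1)) ^+ (k + k)],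
    which tends to [0]. Enlarging [L] by [1] makes the ratio less than one; only some segment is
    needed. *)
Lemma even_moments_supported mu L : 0 <= L ->
  (forall k, mu.-integrable setT (fun x : R => (x ^+ k)%:E)) ->
  (forall k, \int[mu]_x (x ^+ (k + k)) <= L ^+ (k + k)) ->
  supported_in mu (L + 1).
Proof.
move=> L0 im hm.
pose L1 := L + 1; rewrite /supported_in -/L1.
have L10 : 0 < L1 by rewrite ltr_wpDl.
set E := ~` _.
have mE : measurable E by exact: measurableC.
have hE k : (mu E <= ((L / L1) ^+ (k + k))%:E)%E.
  have hx : (\int[mu]_(x in E) (L1 ^+ (k + k))%:E <= (L ^+ (k + k))%:E)%E.
    have pos x : (0 <= (x ^+ (k + k) : R)%:E)%E.
      by rewrite lee_fin exprD -expr2 sqr_ge0.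
    have mx A : measurable_fun A (fun x : measurableTypeR R => ((x : R) ^+ (k + k))%:E).
      by apply/measurable_EFinP; apply: measurable_funX; exact: measurable_id.
    apply: (@le_trans _ _ (\int[mu]_(x in E) (x ^+ (k + k))%:E)%E).
      apply: ge0_le_integral => // x Ex; rewrite lee_fin.
      rewrite addnn -mul2n !exprM; apply: lerXn2r; rewrite ?nnegrE ?sqr_ge0//.
      rewrite -[leRHS]real_normK ?num_real//; apply: lerXn2r; rewrite ?nnegrE//.
        exact: ltW.
      move: Ex; rewrite /E /= in_itv /= -ler_norml => /negP.
      by rewrite -ltNge => /ltW.
    apply: (@le_trans _ _ (\int[mu]_(x in setT) (x ^+ (k + k))%:E)%E).
      exact: ge0_subset_integral.
    rewrite -[leLHS]fineK ?lee_fin; first exact: hm.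
    exact: (integrable_fin_num _ (im _)).
  move: hx; rewrite integral_cst// expr_div_n EFinM.
  rewrite -[leLHS]/(_ * mu E)%E => hx.
  have p0 : 0 < L1 ^+ (k + k) by rewrite exprn_gt0.
  by rewrite lee_pdivlMr// muleC.
have fE : mu E \is a fin_num by exact: fin_num_measure.
rewrite -[LHS]fineK//; congr EFin.
apply/eqP; rewrite eq_le fine_ge0 ?measure_ge0// andbT.
have r0 : (fun k => 1 * (L / L1) ^+ k) @ \oo --> (0 : R).
  apply: cvg_geometric; rewrite ger0_norm ?divr_ge0// ?ltW//.
  by rewrite ltr_pdivrMr// mul1r ltrDl.
apply: (cvgr_to_ge r0); near=> k.
rewrite mul1r -lee_fin fineK//; apply: le_trans (hE k) _.
rewrite lee_fin; apply: ler_wiXn2l; last exact: leq_addr.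
  by rewrite divr_ge0// ltW.
by rewrite ler_pdivrMr// mul1r lerDl.
Unshelve. all: by end_near. Qed.

End BoundedSupport.

Section ContinuousIntegrands.
Context {R : realType}.
Variables (mu : probability (measurableTypeR R) R) (L : R).
Hypothesis muL : supported_in mu L.
Implicit Types f g : R -> R.

Let D : set R := `[- L, L]%classic.

Lemma measurable_segment : measurable (D : set (measurableTypeR R)).
Proof. exact: measurable_itv. Qed.
Local Notation mD := measurable_segment.

Lemma probability_segment : mu D = 1%E.
Proof.
have := probability_setC mu mD; rewrite (_ : mu (~` D) = 0%E)//.
have : mu D \is a fin_num by apply: fin_num_measure; exact: mD.
by case: (mu D) => // r _ [] /eqP; rewrite eq_sym subr_eq0 => /eqP <-.
Qed.

Lemma continuous_integrable f : {in D, continuous f} ->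
  mu.-integrable D (EFin \o f).
Proof.
move=> cf.
have cfD : {within D, continuous f} by exact: continuous_in_subspaceT.
apply: measurable_bounded_integrable.
- exact: mD.
- exact: le_lt_trans (probability_le1 mu mD) (ltry 1).
- exact: (subspace_continuous_measurable_fun mD cfD).
- have /compact_bounded[M [Mr hM]] : compact (f @` D).
    by apply: continuous_compact => //; exact: segment_compact.
  exists M; split => // x xM y Dy; apply: hM => //; by exists y.
Qed.

Lemma integral_segment f : mu.-integrable setT (EFin \o f) ->
  \int[mu]_x f x = \int[mu]_(x in D) f x.
Proof.
move=> intf; congr fine.
have mND : measurable (~` D : set (measurableTypeR R)).
  by apply: measurableC; exact: mD.
have := negligible_integral mND measurableT intf muL.
by rewrite setTD setCK.
Qed.

Lemma integral_segment_cst (c : R) : \int[mu]_(x in D) c = c.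
Proof.
transitivity (c * fine (mu D)); first exact: (Rintegral_cst mu mD).
by rewrite probability_segment mulr1.
Qed.

Lemma integral_segment_le f g : {in D, continuous f} -> {in D, continuous g} ->
  (forall x, D x -> f x <= g x) -> \int[mu]_(x in D) f x <= \int[mu]_(x in D) g x.
Proof.
move=> cf cg.
exact: (le_Rintegral mD (continuous_integrable cf) (continuous_integrable cg)).
Qed.

Lemma in_continuous_cst (c : R) : {in D, continuous (fun=> c : R)}.
Proof. by move=> x _; exact: cvg_cst. Qed.

Lemma integral_segment_ge f c : {in D, continuous f} ->
  (forall x, D x -> c <= f x) -> c <= \int[mu]_(x in D) f x.
Proof.
move=> cf h; rewrite -(integral_segment_cst c); apply: integral_segment_le => //.
exact: in_continuous_cst.
Qed.

Lemma integral_segment_ub f c : {in D, continuous f} ->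
  (forall x, D x -> f x <= c) -> \int[mu]_(x in D) f x <= c.
Proof.
move=> cf h; rewrite -[leRHS](integral_segment_cst c); apply: integral_segment_le => //.
exact: in_continuous_cst.
Qed.

Lemma integral_segment_norm_le f c : {in D, continuous f} ->
  (forall x, D x -> `|f x| <= c) -> `|\int[mu]_(x in D) f x| <= c.
Proof.
move=> cf h; rewrite ler_norml; apply/andP; split.
  by apply: integral_segment_ge => // x /h; rewrite ler_norml => /andP[].
by apply: integral_segment_ub => // x /h; rewrite ler_norml => /andP[].
Qed.

Lemma integral_segmentZ f c : {in D, continuous f} ->
  \int[mu]_(x in D) (c * f x) = c * \int[mu]_(x in D) f x.
Proof. by move=> cf; exact: (RintegralZl _ mD (continuous_integrable cf)). Qed.

Lemma integral_segmentD f g : {in D, continuous f} -> {in D, continuous g} ->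
  \int[mu]_(x in D) (f x + g x) = \int[mu]_(x in D) f x + \int[mu]_(x in D) g x.
Proof. move=> cf cg.
exact: (RintegralD mD (continuous_integrable cf) (continuous_integrable cg)).
Qed.

Lemma integral_segmentB f g : {in D, continuous f} -> {in D, continuous g} ->
  \int[mu]_(x in D) (f x - g x) = \int[mu]_(x in D) f x - \int[mu]_(x in D) g x.
Proof. move=> cf cg.
exact: (RintegralB mD (continuous_integrable cf) (continuous_integrable cg)).
Qed.

Lemma eq_integral_segment f g : (forall x, D x -> f x = g x) ->
  \int[mu]_(x in D) f x = \int[mu]_(x in D) g x.
Proof. by move=> fg; apply: eq_Rintegral => x /set_mem; exact: fg. Qed.

Lemma in_continuousX f n : {in D, continuous f} -> {in D, continuous (fun x => f x ^+ n)}.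
Proof.
move=> cf x xD; apply: (@continuous_comp _ _ _ f (fun y : R => y ^+ n)).
  exact: cf.
exact: exprn_continuous.
Qed.

Lemma in_continuousM f g : {in D, continuous f} -> {in D, continuous g} ->
  {in D, continuous (fun x => f x * g x)}.
Proof. by move=> cf cg x xD; apply: cvgM; [exact: cf|exact: cg]. Qed.

Lemma in_continuousD f g : {in D, continuous f} -> {in D, continuous g} ->
  {in D, continuous (fun x => f x + g x)}.
Proof. by move=> cf cg x xD; apply: cvgD; [exact: cf|exact: cg]. Qed.

Lemma in_continuousB f g : {in D, continuous f} -> {in D, continuous g} ->
  {in D, continuous (fun x => f x - g x)}.
Proof. by move=> cf cg x xD; apply: cvgB; [exact: cf|exact: cg]. Qed.

Lemma in_continuousZ f c : {in D, continuous f} ->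
  {in D, continuous (fun x => c * f x)}.
Proof. by move=> cf; apply: in_continuousM => //; exact: in_continuous_cst. Qed.

Lemma in_continuousV f : {in D, continuous f} -> (forall x, D x -> f x != 0) ->
  {in D, continuous (fun x => (f x)^-1)}.
Proof. by move=> cf f0 x xD; apply: cvgV; [apply: f0; exact/set_mem|exact: cf]. Qed.

Lemma in_continuous_id : {in D, continuous (fun x : R => x)}.
Proof. by move=> x _; exact: cvg_id. Qed.

(** On the segment the geometric series of [(1 - v * f x)^-1] has remainder at most
    [(1 - q)^-1 * q ^+ N] with [q = |v| K], uniformly in [x], hence also after integration. It
    serves for [f x = x], giving moments, and for [f x = L ^+ 2 - x ^+ 2], giving the
    continuation. *)
Lemma has_psum_resolvent f (K : R) : 0 < K -> {in D, continuous f} ->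
  (forall x, D x -> `|f x| <= K) ->
  has_psum K^-1 (fun n => \int[mu]_(x in D) (f x ^+ n))
    (fun v => \int[mu]_(x in D) (1 - v * f x)^-1).
Proof.
move=> K0 cf fK.
have cX n : {in D, continuous (fun x => f x ^+ n)} by exact: in_continuousX.
have aK n : `|\int[mu]_(x in D) (f x ^+ n)| <= K ^+ n.
  apply: integral_segment_norm_le => // x Dx.
  by rewrite normrX; apply: lerXn2r; rewrite ?nnegrE ?(ltW K0)//; exact: fK.
split=> [q /andP[q0 qK]|v vK].
  exists 1 => // n; apply: (@le_trans _ _ (K ^+ n * q ^+ n)).
    by apply: ler_wpM2r => //; exact: exprn_ge0.
  rewrite -exprMn; apply: exprn_ile1; first by rewrite mulr_ge0// ltW.
  by rewrite mulrC -ler_pdivlMr// div1r ltW.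
pose q := `|v| * K.
have q0 : 0 <= q by rewrite mulr_ge0// ltW.
have q1 : q < 1 by rewrite /q -ltr_pdivlMr// div1r.
have d0 : 0 < 1 - q by rewrite subr_gt0.
have vf x : D x -> `|v * f x| <= q by move=> Dx; rewrite normrM ler_wpM2l// fK.
have den x : D x -> 1 - q <= 1 - v * f x.
  by move=> Dx; rewrite lerB// (le_trans _ (vf x Dx))// ler_norm.
have den0 x : D x -> 1 - v * f x != 0.
  by move=> Dx; rewrite gt_eqF// (lt_le_trans d0)// den.
have cV : {in D, continuous (fun x => (1 - v * f x)^-1)}.
  by apply: in_continuousV => //; apply: in_continuousB;
    [exact: in_continuous_cst|exact: in_continuousZ].
have cS N : {in D, continuous (fun x => \sum_(i < N) (v * f x) ^+ i)} /\
    series (fun n => \int[mu]_(x in D) (f x ^+ n) * v ^+ n) N =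
    \int[mu]_(x in D) \sum_(i < N) (v * f x) ^+ i.
  elim: N => [|N [IHc IH]].
    rewrite (_ : (fun x => _) = (fun=> 0)); last by apply/funext => x; rewrite big_ord0.
    split; first exact: in_continuous_cst.
    by rewrite integral_segment_cst seriesEord /= big_ord0.
  have cN : {in D, continuous (fun x => (v * f x) ^+ N)}.
    by apply: in_continuousX; exact: in_continuousZ.
  rewrite (_ : (fun x => _) =
      (fun x => \sum_(i < N) (v * f x) ^+ i + (v * f x) ^+ N)); last first.
    by apply/funext => x; rewrite big_ord_recr.
  split; first exact: in_continuousD.
  rewrite seriesSr IH integral_segmentD//; congr (_ + _).
  rewrite mulrC -integral_segmentZ//.
  by apply: eq_integral_segment => x _; rewrite exprMn.
apply: (@cvg_geo_bounded _ _ _ (1 - q)^-1 q); first by rewrite q0.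
move=> N; rewrite (cS N).2 -integral_segmentB//; last exact: (cS N).1.
apply: integral_segment_norm_le; first by apply: in_continuousB => //; exact: (cS N).1.
move=> x Dx.
have -> : (1 - v * f x)^-1 - \sum_(i < N) (v * f x) ^+ i =
    (1 - v * f x)^-1 * (v * f x) ^+ N.
  have e : (1 - v * f x) * \sum_(i < N) (v * f x) ^+ i = 1 - (v * f x) ^+ N.
    by rewrite -[LHS]opprK -mulNr opprB -subrX1 opprB.
  apply: (mulfI (den0 x Dx)); rewrite mulrBr e mulrA divff ?den0//; ring.
rewrite normrM normrX; apply: ler_pM => //; rewrite ?normr_ge0 ?exprn_ge0//.
  rewrite normfV lef_pV2 ?posrE//.
    by rewrite (le_trans (den x Dx))// ler_norm.
  by rewrite normr_gt0 den0.
by apply: lerXn2r; rewrite ?nnegrE// vf.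
Qed.

End ContinuousIntegrands.

(** * The functional equation *)

Section FunctionalEquation.
Context {R : realType}.
Implicit Types (mu nu : probability (measurableTypeR R) R) (L s t v z : R).

Lemma has_psum_unique rho (a : nat -> R) f g v : has_psum rho a f -> has_psum rho a g ->
  `|v| < rho -> f v = g v.
Proof.
move=> [_ hf] [_ hg] vr.
exact: cvg_unique (hf v vr) (hg v vr).
Qed.

Lemma has_psum_sub rho rho' (a : nat -> R) f :
  rho' <= rho -> has_psum rho a f -> has_psum rho' a f.
Proof.
move=> rr [ha sa]; split=> [q /andP[q0 qr]|v vr].
  by apply: ha; rewrite q0 (lt_le_trans qr).
by apply: sa; exact: lt_le_trans rr.
Qed.

Definition stieltjes mu L s : R := \int[mu]_(x in `[- L, L]) (s + x ^+ 2)^-1.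

(** Linked to the other transform by [stieltjes mu L s = s^-1 * H mu L (- s^-1)]; for a symmetric
    law the moment series at [z] is [H] at [z ^+ 2]. *)
Let H mu L t : R := \int[mu]_(x in `[- L, L]) (1 - t * x ^+ 2)^-1.

Lemma in_continuous_sqr L : {in `[- L, L]%classic, continuous (fun x : R => x ^+ 2)}.
Proof. by apply: in_continuousX; exact: in_continuous_id. Qed.

Lemma resolvent_even_part mu L z : 0 < L -> supported_in mu L -> `|z| < L^-1 ->
  (\int[mu]_(x in `[- L, L]) (1 - z * x)^-1
    + \int[mu]_(x in `[- L, L]) (1 - (- z) * x)^-1) / 2 = H mu L (z ^+ 2).
Proof.
move=> L0 mL zL.
have cl u : {in `[- L, L]%classic, continuous (fun x : R => 1 - u * x)}.
  apply: in_continuousB; first exact: in_continuous_cst.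
  by apply: in_continuousZ; exact: in_continuous_id.
have ne0 u x : `|u| < L^-1 -> `[- L, L]%classic x -> 1 - u * x != 0.
  move=> uL; rewrite /= in_itv /= -ler_norml => xL.
  rewrite gt_eqF// subr_gt0; apply: le_lt_trans (ler_norm _) _.
  rewrite normrM; apply: (@le_lt_trans _ _ (`|u| * L)); first exact: ler_wpM2l.
  by rewrite -ltr_pdivlMr// div1r.
have zL' : `|- z| < L^-1 by rewrite normrN.
rewrite -integral_segmentD//; last 2 first.
- by apply: in_continuousV => // x; exact: ne0.
- by apply: in_continuousV => // x; exact: ne0.
rewrite mulrC -integral_segmentZ//; last first.
  by apply: in_continuousD; apply: in_continuousV => // x; exact: ne0.
apply: eq_integral_segment => x Dx.
have h1 := ne0 _ _ zL Dx; have h2 := ne0 _ _ zL' Dx.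
have e : 1 - z ^+ 2 * x ^+ 2 = (1 - z * x) * (1 - (- z) * x) by ring.
rewrite e; field.
by apply/andP; split; [move: h2; rewrite mulNr opprK|].
Qed.

Variables (muX muY muXY : probability (measurableTypeR R) R) (L : R).
Hypotheses (L0 : 0 < L) (mX : supported_in muX L) (mY : supported_in muY L)
  (mXY : supported_in muXY L).

Let p mu n : R := \int[mu]_(x in `[- L, L]) (x ^+ n).

Hypotheses (oX : forall n, odd n -> p muX n = 0) (oY : forall n, odd n -> p muY n = 0).

Variables a b : nat -> R.
Hypotheses (a0 : a 0%N = 1) (b0 : b 0%N = 1)
  (aS : forall n, a n.+1 = \sum_(k < n.+1) p muX k.+1 * b (n - k)%N)
  (bS : forall n, b n.+1 = \sum_(k < n.+1) p muY k.+1 * a (n - k)%N)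
  (wS : forall n, p muXY n.+1 = a n.+1 + b n.+1).

Let P mu z : R := \int[mu]_(x in `[- L, L]) (1 - z * x)^-1.

(** Half the radius of the moment series, because [a] and [b] are only bounded by [(2 * L) ^+ n]. *)
Let rho : R := (2 * L)^-1.

Let psumP mu : supported_in mu L -> has_psum L^-1 (p mu) (P mu).
Proof.
move=> mL; apply: has_psum_resolvent => //; first exact: in_continuous_id.
by move=> x; rewrite /= in_itv /= -ler_norml.
Qed.

Let rhoL : rho <= L^-1.
Proof. by rewrite lef_pV2 ?posrE ?mulr_gt0//; move: L0; lra. Qed.

Let p_le mu n : supported_in mu L -> `|p mu n| <= L ^+ n.
Proof.
move=> mL; apply: integral_segment_norm_le => //.
  by apply: in_continuousX; exact: in_continuous_id.
move=> x; rewrite /= in_itv /= -ler_norml => xL.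
by rewrite normrX lerXn2r ?nnegrE// ltW.
Qed.

Let p0 mu : supported_in mu L -> p mu 0%N = 1.
Proof. by move=> mL; rewrite /p integral_segment_cst. Qed.

(** The recursion bounds the next coefficient by [L ^+ m.+1] times the sum of the [2 ^+ (m - k)],
    which is [2 ^+ m.+1 - 1]. *)
Let ab_le n : `|a n| <= (2 * L) ^+ n /\ `|b n| <= (2 * L) ^+ n.
Proof.
have key mu (c d : nat -> R) m : supported_in mu L ->
    c m.+1 = \sum_(k < m.+1) p mu k.+1 * d (m - k)%N ->
    (forall k, (k <= m)%N -> `|d k| <= (2 * L) ^+ k) -> `|c m.+1| <= (2 * L) ^+ m.+1.
  move=> mL -> hd; apply: le_trans (ler_norm_sum _ _ _) _.
  apply: (@le_trans _ _ (\sum_(k < m.+1) L ^+ m.+1 * 2 ^+ (m - k))).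
    apply: ler_sum => k _.
    have -> : L ^+ m.+1 * 2 ^+ (m - k) = L ^+ k.+1 * (2 * L) ^+ (m - k).
      rewrite exprMn mulrCA mulrC; congr (_ * _); rewrite -exprD; congr (_ ^+ _).
      by rewrite addSn subnKC// -ltnS.
    by rewrite normrM; apply: ler_pM => //; [exact: p_le|apply: hd; exact: leq_subr].
  rewrite -mulr_sumr exprMn mulrC; apply: ler_wpM2r.
    by rewrite exprn_ge0// ltW.
  rewrite (reindex_inj rev_ord_inj)/=.
  under eq_bigr => i _ do rewrite subSS subKn -1?ltnS//.
  have := subrX1 (2 : R) m.+1; rewrite (_ : 2 - 1 = 1 :> R) ?mul1r; last by ring.
  by move=> <-; rewrite gerBl.
elim/ltn_ind: n => -[|n] IH; first by rewrite a0 b0 normr1 expr0.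
split; first by apply: (key muX a b) => // k kn; case: (IH k kn).
by apply: (key muY b a) => // k kn; case: (IH k kn).
Qed.

Let cb (c : nat -> R) : (forall n, `|c n| <= (2 * L) ^+ n) -> coef_bounded rho c.
Proof.
move=> hc q /andP[q0 qr]; exists 1 => // n.
have L2 : 0 < 2 * L by rewrite mulr_gt0.
apply: (@le_trans _ _ ((2 * L) ^+ n * q ^+ n)).
  by apply: ler_wpM2r => //; exact: exprn_ge0.
rewrite -exprMn; apply: exprn_ile1; first by rewrite mulr_ge0// ltW.
by rewrite mulrC -ler_pdivlMr// div1r ltW.
Qed.

(** The coefficient recursion is a convolution with [P mu - 1], whose constant coefficient vanishes;
    this accounts for the shifted index [k.+1]. *)
Let recursion mu (c d : nat -> R) f g z : supported_in mu L -> c 0%N = 1 ->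
  (forall n, c n.+1 = \sum_(k < n.+1) p mu k.+1 * d (n - k)%N) ->
  has_psum rho c f -> has_psum rho d g -> `|z| < rho ->
  f z = 1 + (P mu z - 1) * g z.
Proof.
move=> mL c0 cS hc hd zr.
have hP := has_psum_sub rhoL (psumP mL).
have := has_psumD (has_psum_poly rho 1%:P)
  (has_psumM (has_psumD hP (has_psum_poly rho (-1)%:P)) hd).
rewrite (_ : (fun n => _) = c) => [h|].
  by rewrite (has_psum_unique hc h zr) !hornerC.
apply/funext => -[|n].
  rewrite /conv big_ord_recl big_ord0 /= !coefC/= p0//; rewrite c0; ring.
rewrite cS /conv big_ord_recl /= !coefC /= p0// subrr mul0r !add0r.
by apply: eq_bigr => i _; rewrite /bump /= add1n coefC /= addr0 subSS.
Qed.

Let P_even mu z : supported_in mu L -> (forall n, odd n -> p mu n = 0) ->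
  `|z| < L^-1 -> P mu (- z) = P mu z.
Proof.
move=> mL on zL; have [_ h] := psumP mL.
have zL' : `|- z| < L^-1 by rewrite normrN.
apply: cvg_unique (h _ zL') _ => //.
rewrite (_ : series _ = series (fun n => p mu n * z ^+ n)); first exact: h.
congr series; apply/funext => n.
have [n1|n0] := boolP (odd n); first by rewrite on// !mul0r.
by rewrite exprNn -signr_odd (negbTE n0) expr0 mul1r.
Qed.

Let P_H mu z : supported_in mu L -> P mu (- z) = P mu z -> `|z| < L^-1 ->
  P mu z = H mu L (z ^+ 2).
Proof.
by move=> mL e zL; rewrite -resolvent_even_part// -/(P mu z) -/(P mu (- z)) e; field.
Qed.

(** Ensures that [P muX z * P muY z] is nonzero, so that a factor can be cancelled in [H_eq]. *)
Let H_ge1 mu z : supported_in mu L -> `|z| < L^-1 -> 1 <= H mu L (z ^+ 2).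
Proof.
move=> mL zL.
have zz x : `[- L, L]%classic x -> z ^+ 2 * x ^+ 2 < 1.
  move=> /sqr_le_segment xL.
  apply: (@le_lt_trans _ _ (z ^+ 2 * L ^+ 2)); first by rewrite ler_wpM2l// sqr_ge0.
  rewrite -exprMn -real_normK ?num_real// expr_lt1// normrM (gtr0_norm L0).
  by rewrite -ltr_pdivlMr// div1r.
apply: integral_segment_ge => //.
  apply: in_continuousV; last by move=> x /zz h; rewrite gt_eqF// subr_gt0.
  apply: in_continuousB; first exact: in_continuous_cst.
  by apply: in_continuousZ; exact: in_continuous_sqr.
by move=> x /zz h; rewrite invf_ge1 ?subr_gt0// gerBl mulr_ge0 ?sqr_ge0.
Qed.

Let H_eq z : `|z| < rho ->
  H muXY L (z ^+ 2) * (H muX L (z ^+ 2) + H muY L (z ^+ 2)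
    - H muX L (z ^+ 2) * H muY L (z ^+ 2)) = H muX L (z ^+ 2) * H muY L (z ^+ 2).
Proof.
move=> zr.
have [A hA] := coef_bounded_has_psum (cb (fun n => (ab_le n).1)).
have [B hB] := coef_bounded_has_psum (cb (fun n => (ab_le n).2)).
(* The linear system for [A v], [B v] has determinant [1 - (x - 1) * (y - 1) = x + y - x * y];
   multiplying [A v + B v - 1] by it avoids any division. *)
have W v : `|v| < rho -> P muXY v * (P muX v + P muY v - P muX v * P muY v) =
    P muX v * P muY v.
  move=> vr.
  have eA := recursion mX a0 aS hA hB vr.
  have eB := recursion mY b0 bS hB hA vr.
  have eW : P muXY v = A v + B v - 1.
    have := has_psumD (has_psumD hA hB) (has_psum_poly rho (-1)%:P).
    rewrite (_ : (fun n => _) = p muXY) => [h|].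
      by rewrite (has_psum_unique (has_psum_sub rhoL (psumP mXY)) h vr) hornerC.
    apply/funext => -[|n]; first by rewrite coefC /= a0 b0 p0//; ring.
    by rewrite coefC /= addr0 wS.
  rewrite eW.
  move: eA eB; set x := P muX v; set y := P muY v; set u := A v; set w := B v.
  move=> eA eB.
  have d1 : u * (1 - (x - 1) * (y - 1)) = x.
    have e : u = x + (x - 1) * (y - 1) * u by rewrite [LHS]eA eB; ring.
    by rewrite mulrBr mulr1 {1}e; ring.
  have d2 : w * (1 - (x - 1) * (y - 1)) = y.
    have e : w = y + (x - 1) * (y - 1) * w by rewrite [LHS]eB eA; ring.
    by rewrite mulrBr mulr1 {1}e; ring.
  have -> : x + y - x * y = 1 - (x - 1) * (y - 1) by ring.
  by rewrite mulrBl mulrDl d1 d2; ring.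
have zL : `|z| < L^-1 := lt_le_trans zr rhoL.
have zr' : `|- z| < rho by rewrite normrN.
have eX := P_even mX oX zL; have eY := P_even mY oY zL.
have hX := P_H mX eX zL; have hY := P_H mY eY zL.
have gX := H_ge1 mX zL; have gY := H_ge1 mY zL.
(* Evenness for the sum is deduced, not assumed: [W] at [z] and at [- z] has the same coefficients,
   and the common factor is nonzero because [P muX z * P muY z] is. *)
have eXY : P muXY (- z) = P muXY z.
  have w1 := W _ zr; have w2 := W _ zr'; rewrite eX eY in w2.
  have ne : P muX z + P muY z - P muX z * P muY z != 0.
    apply/eqP => e; move: w1; rewrite e mulr0 hX hY => /esym/eqP.
    by rewrite mulf_eq0 !gt_eqF// (lt_le_trans ltr01).
  by apply: (mulIf ne); rewrite w1 w2.
by have := W _ zr; rewrite hX hY (P_H mXY eXY zL).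
Qed.

(** Continuation through [s = oo]. With [v = (s + K)^-1] one has [s + x ^+ 2 = v^-1 * (1 - v * (K -
    x ^+ 2))], and [K - x ^+ 2] stays in [[0, K]]. So the series in [v] converges for [|v| < K^-1],
    which includes every [s > 0]; an expansion in [x ^+ 2 / s] would reach only large [s]. *)
Lemma stieltjes_boolean_sum s : 0 < s ->
  stieltjes muXY L s *
    (stieltjes muX L s + stieltjes muY L s - s * (stieltjes muX L s * stieltjes muY L s))
  = stieltjes muX L s * stieltjes muY L s.
Proof.
move=> s0.
pose K := L ^+ 2.
have K0 : 0 < K by exact: exprn_gt0.
pose G mu v : R := \int[mu]_(x in `[- L, L]) (1 - v * (K - x ^+ 2))^-1.
have hG mu : supported_in mu L -> exists c, has_psum K^-1 c (G mu).
  move=> mL; eexists; apply: has_psum_resolvent => //.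
    by apply: in_continuousB; [exact: in_continuous_cst|exact: in_continuous_sqr].
  move=> x /sqr_le_segment xK; have := sqr_ge0 x; rewrite ger0_norm ?subr_ge0//.
  by rewrite gerBl.
have [cX hX] := hG _ mX; have [cY hY] := hG _ mY; have [cXY hXY] := hG _ mXY.
(* For [v = 1 / (s + K)] the equation [F v = 0] is the claim; for small negative
   [v] it is [H_eq] at [z^2 = - v / (1 - v K)]. *)
pose F v := G muXY v * (G muX v + G muY v + (K%:P * 'X - 1%:P).[v] * (G muX v * G muY v))
  + (-1)%:P.[v] * (G muX v * G muY v).
(* After rescaling [stieltjes] to [G], the coefficient [s] of the claim becomes [s * v = 1 - K * v],
   a polynomial in [v]. *)
have FE v : F v = G muXY v * (G muX v + G muY v - (1 - K * v) * (G muX v * G muY v))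
    - G muX v * G muY v.
  rewrite /F hornerD hornerN hornerM !hornerC hornerX; ring.
have [cF hF] : exists c, has_psum K^-1 c F.
  eexists; apply: has_psumD; last first.
    by apply: has_psumM; [exact: has_psum_poly|exact: has_psumM hX hY].
  apply: (has_psumM hXY); apply: has_psumD; first exact: has_psumD hX hY.
  by apply: has_psumM; [exact: has_psum_poly|exact: has_psumM hX hY].
have F0 v : `|v| < K^-1 -> F v = 0.
  (* This is [rho ^+ 2]: it makes [t <= - v < rho ^+ 2], so that [H_eq] applies at [Num.sqrt t]. *)
  have e0 : 0 < (4 * K)^-1 by rewrite invr_gt0 mulr_gt0.
  apply: (has_psum_eq0 e0 hF) => {}v /andP[v1 v2].
  have vK : v * K < 0 by rewrite nmulr_rlt0.
  have d0 : 0 < 1 - v * K by rewrite subr_gt0 (lt_trans vK).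
  pose t := - v / (1 - v * K).
  have t0 : 0 <= t by rewrite divr_ge0// ?ltW// oppr_gt0.
  have tv : t <= - v.
    rewrite ler_pdivrMr// -subr_ge0 (_ : _ - _ = v * (v * K)); last by ring.
    by rewrite mulr_le0 ?ltW.
  have tr : `|Num.sqrt t| < rho.
    rewrite ger0_norm ?sqrtr_ge0// -(@ltr_pXn2r _ 2)// ?nnegrE ?sqrtr_ge0 ?invr_ge0 ?mulr_ge0 ?ltW//.
    rewrite sqr_sqrtr// /rho exprVn exprMn; apply: le_lt_trans tv _.
    by move: v1; rewrite ltrNl -/K (_ : 2 ^+ 2 = 4)//; ring.
  have HE := H_eq tr; rewrite sqr_sqrtr// in HE.
  have GH mu : supported_in mu L -> G mu v = (1 - v * K)^-1 * H mu L t.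
    move=> mL; rewrite -integral_segmentZ//; last first.
      apply: in_continuousV => [|x Dx].
        apply: in_continuousB; first exact: in_continuous_cst.
        by apply: in_continuousZ; exact: in_continuous_sqr.
      rewrite gt_eqF// subr_gt0; apply: le_lt_trans (ler_wpM2l t0 (sqr_le_segment Dx)) _.
      rewrite -/K -ltr_pdivlMr// div1r; apply: le_lt_trans tv _.
      rewrite ltrNl; apply: lt_trans v1; rewrite ltrN2 ltf_pV2 ?posrE ?mulr_gt0//.
      by rewrite ltr_pMl// ltr1n.
    apply: eq_integral_segment => x _; rewrite -invfM; congr (_^-1).
    by rewrite /t; field; rewrite gt_eqF.
  rewrite FE !GH//.
  move: HE; set x := H muX L t; set y := H muY L t; set w := H muXY L t => HE.
  rewrite (_ : _ - _ = (1 - v * K)^-1 ^+ 2 * (w * (x + y - x * y) - x * y)).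
    by rewrite HE subrr mulr0.
  by field; rewrite gt_eqF.
have sK : 0 < s + K by exact: addr_gt0.
pose v := (s + K)^-1.
have v0 : 0 < v by rewrite invr_gt0.
have GE mu : supported_in mu L -> G mu v = (s + K) * stieltjes mu L s.
  move=> mL; rewrite -integral_segmentZ//; last first.
    apply: in_continuousV => [|x _].
      by apply: in_continuousD; [exact: in_continuous_cst|exact: in_continuous_sqr].
    by rewrite gt_eqF// ltr_pwDl// sqr_ge0.
  apply: eq_integral_segment => x _; rewrite -[X in X / _]invrK -/v -invfM.
  congr (_^-1); rewrite /v; field; rewrite gt_eqF//.
have := F0 v; rewrite FE !GE// => /(_ _).
set x := stieltjes muX L s; set y := stieltjes muY L s; set w := stieltjes muXY L s.
have -> : 1 - K * v = s * v by rewrite /v; field; rewrite gt_eqF.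
move=> h; apply/eqP; rewrite -subr_eq0 -(@mulrI_eq0 _ ((s + K) ^+ 2)); last first.
  by apply/mulfI; rewrite expf_neq0// gt_eqF.
rewrite -[X in _ == X]h; last by rewrite gtr0_norm// ltf_pV2 ?posrE// ltrDr.
by apply/eqP; rewrite /v; field; rewrite gt_eqF.
Qed.

End FunctionalEquation.

(** * Monotonicity *)

Section Monotonicity.
Context {R : realType}.
Implicit Types (mu : probability (measurableTypeR R) R) (L s : R).

Definition log_potential mu L s : R := \int[mu]_(x in `[- L, L]) ln (s + x ^+ 2).

Lemma addr_sqr_gt0 s (x : R) : 0 < s -> 0 < s + x ^+ 2.
Proof. by move=> s0; rewrite ltr_pwDl// sqr_ge0. Qed.

Lemma in_continuous_ln_sqr L s : 0 < s ->
  {in `[- L, L]%classic, continuous (fun x : R => ln (s + x ^+ 2))}.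
Proof.
move=> s0 x xL; apply: (@continuous_comp _ _ _ (fun x : R => s + x ^+ 2) (@ln R) x).
  by apply: cvgD; [exact: cvg_cst|exact: exprn_continuous].
by apply: continuous_ln; exact: addr_sqr_gt0.
Qed.

Lemma in_continuous_stieltjes L s : 0 < s ->
  {in `[- L, L]%classic, continuous (fun x : R => (s + x ^+ 2)^-1)}.
Proof.
move=> s0; apply: in_continuousV => [|x _]; last by rewrite gt_eqF// addr_sqr_gt0.
by apply: in_continuousD; [exact: in_continuous_cst|exact: in_continuous_sqr].
Qed.

Lemma stieltjes_le mu L s : supported_in mu L -> 0 < s -> stieltjes mu L s <= s^-1.
Proof.
move=> mL s0; apply: integral_segment_ub => //; first exact: in_continuous_stieltjes.
by move=> x _; rewrite lef_pV2 ?posrE ?addr_sqr_gt0// lerDl sqr_ge0.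
Qed.

Lemma stieltjes_gt0 mu L s : supported_in mu L -> 0 < s -> 0 < stieltjes mu L s.
Proof.
move=> mL s0; apply: (@lt_le_trans _ _ (s + L ^+ 2)^-1).
  by rewrite invr_gt0 addr_sqr_gt0.
apply: integral_segment_ge => //; first exact: in_continuous_stieltjes.
by move=> x /sqr_le_segment xL; rewrite lef_pV2 ?posrE ?addr_sqr_gt0// lerD2l.
Qed.

Lemma expR_log_potential_ge mu L s : supported_in mu L -> 0 < s ->
  s <= expR (log_potential mu L s).
Proof.
move=> mL s0; rewrite -[leLHS]lnK ?posrE// ler_expR.
apply: integral_segment_ge => //; first exact: in_continuous_ln_sqr.
by move=> x _; rewrite ler_ln ?posrE ?addr_sqr_gt0// lerDl sqr_ge0.
Qed.

Lemma expR_log_potential_le mu L s : supported_in mu L -> 0 < s ->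
  expR (log_potential mu L s) <= s + L ^+ 2.
Proof.
move=> mL s0; rewrite -[leRHS]lnK ?posrE ?addr_sqr_gt0// ler_expR.
apply: integral_segment_ub => //; first exact: in_continuous_ln_sqr.
by move=> x /sqr_le_segment xL; rewrite ler_ln ?posrE ?addr_sqr_gt0// lerD2l.
Qed.

(* Jensen's inequality, from [1 + y <= expR y] at [y = log_potential - ln]. *)
Lemma expR_log_potential_stieltjes mu L s : supported_in mu L -> 0 < s ->
  1 <= expR (log_potential mu L s) * stieltjes mu L s.
Proof.
move=> mL s0; set c := log_potential mu L s.
have cV := @in_continuous_stieltjes L s s0.
have cl := @in_continuous_ln_sqr L s s0.
rewrite -integral_segmentZ//.
apply: (@le_trans _ _ (\int[mu]_(x in `[- L, L]) (1 + c - ln (s + x ^+ 2)))).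
  rewrite integral_segmentB//; last exact: in_continuous_cst.
  by rewrite integral_segment_cst// -/(log_potential mu L s) -/c addrK.
apply: integral_segment_le => //.
- by apply: in_continuousB => //; exact: in_continuous_cst.
- exact: in_continuousZ.
- move=> x _; rewrite -addrA; apply: le_trans (expR_ge1Dx _) _.
  by rewrite expRD expRN lnK// posrE addr_sqr_gt0.
Qed.

(** Differentiation under the integral on the window from [s / 2] to [2 * s], where the derivative
    of the integrand is dominated by the constant [(s / 2)^-1]. *)
Lemma is_derive_log_potential mu L s : supported_in mu L -> 0 < s ->
  is_derive s (1 : R) (log_potential mu L) (stieltjes mu L s).
Proof.
move=> mL s0.
pose f (t x : R) : R := ln (t + x ^+ 2).
have df (t x : R) : 0 < t -> is_derive t 1 (f ^~ x) (t + x ^+ 2)^-1.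
  move=> t0; have h := is_derive1_ln (addr_sqr_gt0 x t0).
  have hg : is_derive t 1 (fun t : R => t + x ^+ 2) (1 + 0) by exact: is_deriveD.
  have := @is_derive1_comp _ (@ln R) (fun t : R => t + x ^+ 2) _ _ _ h hg.
  by rewrite addr0 mulr1.
have I0 t : `](s / 2), (2 * s)[%classic t -> s / 2 < t.
  by rewrite /= in_itv /= => /andP[].
have I1 t : `](s / 2), (2 * s)[%classic t -> 0 < t.
  by move/I0; apply: lt_trans; rewrite divr_gt0.
have Is : `](s / 2), (2 * s)[%classic s by rewrite /= in_itv /=; apply/andP; split; lra.
have h := @cvg_differentiation_under_integral R _ _ mu f `[- L, L]
  (@measurable_segment R L) s _ _ Is _ _ (fun=> (s / 2)^-1) _ _ _.
have {}h := h (fun t It => continuous_integrable mu (in_continuous_ln_sqr (I1 t It))).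
have {}h := h (fun t x It _ => @ex_derive _ _ _ _ _ _ _ (df t x (I1 t It))).
have dE t x : 0 < t -> partial1of2 f t x = (t + x ^+ 2)^-1.
  by move=> t0; rewrite partial1of2E; have [_ ->] := df t x t0.
have hV : 0 <= (s / 2)^-1 by rewrite invr_ge0 divr_ge0// ltW.
have cV : {in `[- L, L]%classic, continuous (fun=> (s / 2)^-1 : R)}.
  exact: in_continuous_cst.
have {}h := h (fun=> hV) (continuous_integrable mu cV).
have cv : (fun h : R => h^-1 *: (log_potential mu L (h + s) - log_potential mu L s))
    @ 0^' --> stieltjes mu L s.
  rewrite (_ : stieltjes mu L s = \int[mu]_(y in `[- L, L]) partial1of2 f s y).
    apply: h => t x It _; have t0 := I1 t It; rewrite dE// ger0_norm.
      rewrite lef_pV2 ?posrE ?addr_sqr_gt0 ?divr_gt0//.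
      by rewrite (le_trans (ltW (I0 t It)))// lerDl sqr_ge0.
    by rewrite invr_ge0 ltW// addr_sqr_gt0.
  by apply: eq_integral_segment => x _; rewrite dE.
have cv' : (fun h : R => h^-1 *: ((log_potential mu L \o shift s) (h *: (1 : R))
    - log_potential mu L s)) @ 0^' --> stieltjes mu L s.
  by under eq_fun do rewrite /= [_ *: 1]mulr1.
by split; [apply/cvg_ex; exists (stieltjes mu L s) | exact/cvg_lim].
Qed.

Variables (muX muY muXY : probability (measurableTypeR R) R) (L : R).
Hypotheses (mX : supported_in muX L) (mY : supported_in muY L)
  (mXY : supported_in muXY L).
Hypothesis bool_sum : forall s, 0 < s ->
  stieltjes muXY L s *
    (stieltjes muX L s + stieltjes muY L s - s * (stieltjes muX L s * stieltjes muY L s))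
  = stieltjes muX L s * stieltjes muY L s.

Let N mu s := expR (log_potential mu L s).

Let E s := (N muX s + N muY s - s) * expR (- log_potential muXY L s).

Let dE s := (N muX s * stieltjes muX L s + N muY s * stieltjes muY L s - 1
    - (N muX s + N muY s - s) * stieltjes muXY L s) * expR (- log_potential muXY L s).

Let is_derive_E s : 0 < s -> is_derive s 1 E (dE s).
Proof.
move=> s0.
have dN mu : supported_in mu L -> is_derive s 1 (N mu) (N mu s * stieltjes mu L s).
  move=> mL; have h := is_derive_log_potential mL s0.
  exact: (@is_derive1_comp _ expR (log_potential mu L)).
have hX := dN _ mX; have hY := dN _ mY.
have hXY := is_derive_log_potential mXY s0.
have hV : is_derive s 1 (fun t => expR (- log_potential muXY L t))
    (expR (- log_potential muXY L s) * - stieltjes muXY L s).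
  exact: (@is_derive1_comp _ expR (fun t => - log_potential muXY L t)).
apply: is_derive_eq.
rewrite /dE -[LHS]/(_ * (_ * _) + _ * _); ring.
Qed.

Let dE_ge0 s : 0 < s -> 0 <= dE s.
Proof.
move=> s0; apply: mulr_ge0; last exact: expR_ge0.
have hX := stieltjes_gt0 mX s0; have hY := stieltjes_gt0 mY s0.
have hXY := stieltjes_gt0 mXY s0.
have lX := stieltjes_le mX s0; have lY := stieltjes_le mY s0.
have jX := expR_log_potential_stieltjes mX s0.
have jY := expR_log_potential_stieltjes mY s0.
have := bool_sum s0; move: hX hY hXY lX lY jX jY.
rewrite -/(N muX s) -/(N muY s).
set x := stieltjes muX L s; set y := stieltjes muY L s; set w := stieltjes muXY L s.
move=> x0 y0 w0 xs ys; set u := N muX s; set v := N muY s => ux vy e.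
have sx : s * x <= 1 by rewrite mulrC -ler_pdivlMr// div1r.
have sy : s * y <= 1 by rewrite mulrC -ler_pdivlMr// div1r.
(* Since [s * y <= 1], the bracket [x + y - s * (x * y)] is at least [y]. *)
have wx : w <= x.
  rewrite -(ler_pM2r y0) -e ler_pM2l// -subr_ge0.
  by rewrite (_ : _ - _ = x * (1 - s * y)) ?mulr_ge0 ?subr_ge0 ?(ltW x0)//; ring.
have wy : w <= y.
  rewrite -(ler_pM2l x0) -e [leLHS]mulrC ler_pM2l// -subr_ge0.
  by rewrite (_ : _ - _ = y * (1 - s * x)) ?mulr_ge0 ?subr_ge0 ?(ltW y0)//; ring.
have h1 : 0 <= (u * x - 1) * (1 - w / x).
  by rewrite mulr_ge0 ?subr_ge0// ler_pdivrMr// mul1r.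
have h2 : 0 <= (v * y - 1) * (1 - w / y).
  by rewrite mulr_ge0 ?subr_ge0// ler_pdivrMr// mul1r.
(* The first two terms are nonnegative by Jensen's inequality and [w <= x], [w <= y]; the third
   vanishes by the functional equation. *)
rewrite (_ : _ - _ = (u * x - 1) * (1 - w / x) + (v * y - 1) * (1 - w / y)
    + (1 - w * (x + y - s * (x * y)) / (x * y))).
  by rewrite e divff ?mulf_neq0 ?gt_eqF// subrr addr0 addr_ge0.
by field; rewrite !gt_eqF.
Qed.

Let E_homo s t : 0 < s -> s <= t -> E s <= E t.
Proof.
move=> s0 st.
have pos x : x \in `](s / 2), (t + 1)[%R -> 0 < x.
  by rewrite in_itv /= => /andP[+ _]; apply: lt_trans; rewrite divr_gt0.
apply: (@ger0_derive1_le_oo _ E (s / 2) (t + 1)) => //.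
- by move=> x /pos /is_derive_E [].
- by move=> x /pos x0; rewrite derive1E; have [_ ->] := is_derive_E x0; exact: dE_ge0.
- move=> x /set_mem /pos /is_derive_E [d _].
  exact/differentiable_continuous/derivable1_diffP.
- by rewrite in_itv /=; apply/andP; split; lra.
- by rewrite in_itv /=; apply/andP; split; lra.
Qed.

Lemma log_potential_boolean_sum s : 0 < s ->
  expR (log_potential muX L s) + expR (log_potential muY L s) - s
    <= expR (log_potential muXY L s).
Proof.
move=> s0; suff : E s <= 1.
  by rewrite /E expRN -ler_pdivlMr ?invr_gt0 ?expR_gt0// div1r invrK.
apply/ler_addgt0Pl => e e0; rewrite addrC.
(* At [t] the numerator of [E] is at most [t + 2 * L ^+ 2] and its denominator at least [t]; this
   choice makes the quotient at most [1 + e]. *)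
pose t := s + 2 * L ^+ 2 / e.
have q0 : 0 <= 2 * L ^+ 2 / e by rewrite divr_ge0 ?(ltW e0)// mulr_ge0 ?sqr_ge0.
have t0 : 0 < t by rewrite ltr_pwDl.
have st : s <= t by rewrite lerDl.
apply: le_trans (E_homo s0 st) _.
have := expR_log_potential_le mX t0; have := expR_log_potential_le mY t0.
have := expR_log_potential_ge mXY t0.
rewrite /E expRN /N; set w := expR (log_potential muXY L t).
set u := expR (log_potential muX L t); set v := expR _ => tw vY uX.
have w0 : 0 < w := lt_le_trans t0 tw.
rewrite ler_pdivrMr//.
have et : 2 * L ^+ 2 <= t * e by rewrite -ler_pdivrMr// lerDr ltW.
have ew : t * e <= w * e by rewrite ler_pM2r.
rewrite mulrDl mul1r; lra.
Qed.

End Monotonicity.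

(** * The limit at zero *)

Section EntropyLimit.
Context {R : realType}.
Variables (mu : probability (measurableTypeR R) R) (L : R).
Hypothesis mL : supported_in mu L.

Let D : set (measurableTypeR R) := `[- L, L]%classic.

Let mD : measurable D. Proof. exact: measurable_itv. Qed.

Let ell (x : measurableTypeR R) : \bar R := lne (`|x : R|%:E).

Let measurable_ell (A : set (measurableTypeR R)) : measurable_fun A ell.
Proof.
apply: (measurable_funS measurableT) => //.
rewrite /ell /lne; apply: measurable_fun_ifT.
- by apply: measurable_fun_ler => //; exact: measurableT_comp.
- exact: measurable_cst.
- by apply/measurable_EFinP; do 2 apply: measurableT_comp => //.
Qed.

Lemma lne_normr_sqr (x : R) : (2%:E * lne `|x|%:E = lne (x ^+ 2)%:E)%E.
Proof.
have [->|x0] := eqVneq x 0.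
  by rewrite normr0 expr0n /= lexx gt0_muleNy// lte_fin.
have nx : 0 < `|x| by rewrite normr_gt0.
rewrite !lne_EFin//; last by rewrite -real_normK ?num_real// exprn_gt0.
by rewrite -real_normK ?num_real// lnXn// -EFinM mulr_natl.
Qed.

Lemma boolean_entropy_segment :
  boolean_entropy mu = (\int[mu]_(x in D) lne `|x|%:E)%E.
Proof.
rewrite [RHS]integral_mkcond; apply: ae_eq_integral => //.
- exact: (proj1 (measurable_restrictT ell mD) (@measurable_ell D)).
- exists (~` D); split => //; first exact: measurableC.
  move=> x /= nx Dx; apply: nx => _.
  by rewrite patchE mem_set.
Qed.

(** An upper bound on the segment for [ln (s + x ^+ 2)] whenever [0 < s <= 1], hence along
    [harmonic]. *)
Let C : R := ln (1 + L ^+ 2).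

(** Nonnegative on [D], so its integral makes sense even when the entropy is [-oo], and monotone
    convergence applies. *)
Let phi (x : measurableTypeR R) : \bar R := (C%:E - 2%:E * ell x)%E.

Let measurable_phi : measurable_fun D phi.
Proof.
apply: emeasurable_funB; first exact: measurable_cst.
by apply: measurable_funeM; exact (@measurable_ell _).
Qed.

Let ell_le x : D x -> (2%:E * ell x <= C%:E)%E.
Proof.
move=> /sqr_le_segment xL; rewrite /ell lne_normr_sqr /lne.
case: ifPn => [_|]; first exact: leNye.
rewrite -ltNge => x0; rewrite lee_fin ler_ln ?posrE ?addr_sqr_gt0//.
by rewrite (le_trans xL)// lerDr.
Qed.

Let phi_ge0 x : D x -> (0 <= phi x)%E.
Proof.
move=> Dx; rewrite /phi; have := ell_le Dx.
case: (2%:E * ell x)%E => [r||] //=; first by rewrite !lee_fin subr_ge0.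
by rewrite leey.
Qed.

Let C_ge0 : 0 <= C.
Proof. by rewrite ln_ge0// lerDl sqr_ge0. Qed.

Let ellE x : ell x = ((2^-1)%:E * (C%:E - phi x))%E.
Proof.
rewrite /phi /ell /lne; case: ifP => _.
  by rewrite gt0_muleNy ?lte_fin//= gt0_muleNy// lte_fin invr_gt0.
by rewrite -EFinM; congr EFin; field.
Qed.

Let integrable_ell_phi : mu.-integrable D ell -> mu.-integrable D phi.
Proof.
move=> iell; apply: integrableB => //.
  exact: (finite_measure_integrable_cst mu C mD).
exact: integrableZl.
Qed.

(** Linearity settles the integrable case. If [phi] has integral [+oo], then [ell^\+ <= C] has
    finite integral, so that of [ell^\-] must be infinite: otherwise [ell], and with it [phi], would
    be integrable. Both sides are then [-oo]. *)
Lemma boolean_entropy_phi :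
  (2%:E * boolean_entropy mu = C%:E - \int[mu]_(x in D) phi x)%E.
Proof.
rewrite boolean_entropy_segment -/ell -/D.
have iC : mu.-integrable D (EFin \o cst C).
  exact: (finite_measure_integrable_cst mu C mD).
have eC : (\int[mu]_(x in D) C%:E = C%:E)%E.
  transitivity (C%:E * mu D)%E; first exact: integral_cst.
  by rewrite (probability_segment mL) mule1.
have J0 : (0 <= \int[mu]_(x in D) phi x)%E by exact: integral_ge0.
have [Jy|] := ltP (\int[mu]_(x in D) phi x)%E +oo%E.
  have iphi : mu.-integrable D phi.
    apply/integrableP; split => //.
    rewrite (eq_integral phi) // => x /set_mem Dx.
    by rewrite gee0_abs// phi_ge0.
  have iB : mu.-integrable D (fun x => C%:E - phi x)%E by exact: integrableB.
  rewrite (eq_integral (fun x => (2^-1)%:E * (C%:E - phi x))%E); last first.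
    by move=> x _; exact: ellE.
  rewrite integralZl// integralB// eC muleA -EFinM divff// mul1e//.
rewrite leye_eq => /eqP Jy; rewrite Jy.
have pos_fin : (\int[mu]_(x in D) (ell^\+ x) < +oo)%E.
  have iCn : mu.-integrable D (EFin \o cst `|C|).
    exact: (finite_measure_integrable_cst mu _ mD).
  have : (\int[mu]_(x in D) ell^\+ x <= \int[mu]_(x in D) (cst C%:E x))%E.
    apply: ge0_le_integral => //.
    - by apply: measurable_funepos; exact (@measurable_ell _).
    - move=> x Dx; rewrite funeposE ge_max lee_fin C_ge0 andbT.
      have := ell_le Dx; rewrite /ell; case: (lne _) => [r||] h; last exact: leNye.
        by move: h; rewrite -EFinM !lee_fin /=; have := C_ge0; lra.
      by move: h; rewrite gt0_muley ?lte_fin.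
  by move=> h; apply: (le_lt_trans h); rewrite [ltLHS]eC ltry.
have neg_oo : (\int[mu]_(x in D) (ell^\- x) = +oo)%E.
  apply/eqP; rewrite -leye_eq leNgt; apply/negP => neg_fin.
  suff iell : mu.-integrable D ell.
    by have := integrable_lty mD (integrable_ell_phi iell); rewrite Jy.
  apply/integrableP; split; first exact (@measurable_ell _).
  rewrite (_ : (\int[mu]_(x in D) `|ell x|)%E =
      (\int[mu]_(x in D) (ell^\+ x + ell^\- x))%E); last first.
    by apply: eq_integral => x _; rewrite -[LHS]/((abse \o ell) x) fune_abse.
  rewrite ge0_integralD//; first by rewrite lte_add_pinfty.
  - by apply: measurable_funepos; exact (@measurable_ell _).
  - by apply: measurable_funeneg; exact (@measurable_ell _).
by rewrite integralE neg_oo addeNy ?lt_eqF// gt0_muleNy ?lte_fin.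
Qed.

(** Continuity of [ln] away from [0]; at [x = 0] the sequence is [C + ln n.+1], which tends to
    [+oo]. *)
Let phi_cvg x :
  (C - ln (harmonic n + (x : R) ^+ 2))%:E @[n --> \oo] --> phi x.
Proof.
rewrite /phi /ell lne_normr_sqr /lne.
case: ifPn => [x0|]; last first.
  rewrite -ltNge => x0; rewrite -EFinB; apply: cvg_EFin; first exact: nearW.
  apply: cvgB; first exact: cvg_cst.
  have h : (fun n => harmonic n + (x : R) ^+ 2) @ \oo --> (x : R) ^+ 2.
    rewrite -[X in _ --> X]add0r; apply: cvgD; last exact: cvg_cst.
    exact: cvg_harmonic.
  by apply: (cvg_comp _ _ h); exact: continuous_ln.
have {x0} -> : x ^+ 2 = 0 by apply/eqP; rewrite eq_le x0 sqr_ge0.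
rewrite /=; apply/cvgeryP/cvgryPge => A.
near=> n; rewrite addr0 /= lnV ?posrE// opprK.
apply: (@le_trans _ _ (ln n.+1%:R)); last by rewrite lerDr.
rewrite -[leLHS]expRK ler_ln ?posrE ?expR_gt0//.
apply: (@le_trans _ _ n%:R); last by rewrite ler_nat.
by near: n; exact: nbhs_infty_ger.
Unshelve. all: by end_near. Qed.

(** Monotone convergence for [C - ln (harmonic n + x ^+ 2)], which is nonnegative and increases with
    [n]. *)
Lemma log_potential_cvg :
  (log_potential mu L (harmonic n))%:E @[n --> \oo] --> (2%:E * boolean_entropy mu)%E.
Proof.
have h0 n : 0 < harmonic n :> R by rewrite /harmonic /= invr_gt0.
have h1 n : harmonic n <= 1 :> R by rewrite /harmonic /= invf_le1// ler1n.
have cln n : {in `[- L, L]%classic, continuous (fun x : R => ln (harmonic n + x ^+ 2))}.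
  exact: in_continuous_ln_sqr.
have cphi n : {in `[- L, L]%classic, continuous (fun x : R => C - ln (harmonic n + x ^+ 2))}.
  by apply: in_continuousB => //; exact: in_continuous_cst.
have iphi n : mu.-integrable D (fun x => (C - ln (harmonic n + (x : R) ^+ 2))%:E).
  exact: (continuous_integrable mu (cphi n)).
have eU n : (\int[mu]_(x in D) (C - ln (harmonic n + (x : R) ^+ 2))%:E =
    C%:E - (log_potential mu L (harmonic n))%:E)%E.
  rewrite -EFinB -[RHS]/((C - log_potential mu L (harmonic n))%:E).
  rewrite -[LHS]fineK; last exact: integrable_fin_num.
  congr EFin; rewrite -[LHS]/(\int[mu]_(x in `[- L, L]) (C - ln (harmonic n + x ^+ 2))).
  by rewrite integral_segmentB ?integral_segment_cst//; exact: in_continuous_cst.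
have cvJ : (\int[mu]_(x in D) (C - ln (harmonic n + (x : R) ^+ 2))%:E)%E @[n --> \oo]
    --> (\int[mu]_(x in D) phi x)%E.
  have -> : (\int[mu]_(x in D) phi x)%E = (\int[mu]_(x in D)
      limn (fun n => (C - ln (harmonic n + (x : R) ^+ 2))%:E))%E.
    by apply: eq_integral => x _; apply/esym/cvg_lim => //; exact: phi_cvg.
  apply: cvg_monotone_convergence => //.
  - by move=> n; case/integrableP: (iphi n).
  - move=> n x /sqr_le_segment xL; rewrite lee_fin subr_ge0.
    by rewrite ler_ln ?posrE ?addr_sqr_gt0// lerD.
  - move=> x _ n m nm; rewrite lee_fin lerB// ler_ln ?posrE ?addr_sqr_gt0// lerD2r.
    by rewrite /harmonic /= lef_pV2 ?posrE// ler_nat ltnS.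
rewrite boolean_entropy_phi.
have -> : (fun n => (log_potential mu L (harmonic n))%:E) =
    (cst C%:E \- (fun n => \int[mu]_(x in D) (C - ln (harmonic n + (x : R) ^+ 2))%:E))%E.
  apply/funext => n /=; rewrite eU -!EFinB; congr EFin; ring.
by apply: cvgeB => //; exact: cvg_cst.
Qed.

Lemma boolean_entropy_le_log_potential n :
  (2%:E * boolean_entropy mu <= (log_potential mu L (harmonic n))%:E)%E.
Proof.
apply: (cvge_to_le log_potential_cvg); near=> m.
have nm : (n <= m)%N by near: m; exact: nbhs_infty_ge.
have h0 k : 0 < harmonic k :> R by rewrite /harmonic /= invr_gt0.
rewrite lee_fin; apply: integral_segment_le; try exact: in_continuous_ln_sqr.
move=> x _; rewrite ler_ln ?posrE ?addr_sqr_gt0// lerD2r.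
by rewrite /harmonic /= lef_pV2 ?posrE// ler_nat ltnS.
Unshelve. all: by end_near. Qed.

End EntropyLimit.

(** * Symmetric laws and nested segments *)

Lemma symmetric_odd_moment {R : realType}
    (mu : probability (measurableTypeR R) R) (n : nat) :
  symmetric_law mu -> mu.-integrable setT (fun x : R => (x ^+ n)%:E) -> odd n ->
  \int[mu]_x (x ^+ n) = 0.
Proof.
move=> smu imu nodd.
have mN : measurable_fun setT (-%R : measurableTypeR R -> measurableTypeR R).
  exact: oppr_measurable.
suff : \int[mu]_x (x ^+ n) = - \int[mu]_x (x ^+ n) by lra.
rewrite -[in RHS]mulN1r -RintegralZl//.
transitivity (fine (\int[pushforward mu (-%R : measurableTypeR R -> measurableTypeR R)]_x (x ^+ n)%:E)).
  congr fine; apply: eq_measure_integral => B mB _.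
  exact: (esym (smu B mB)).
congr fine; rewrite integral_pushforward//.
- apply: eq_integral => x _ /=; congr EFin.
  by rewrite exprNn -signr_odd nodd expr1.
- by apply/measurable_EFinP; apply: measurable_funX; exact: measurable_id.
- rewrite preimage_setT (_ : _ \o _ = (fun x => (-1)%:E * (x ^+ n)%:E)%E).
    exact: (integrableZl measurableT).
  apply/funext => x /=; rewrite -EFinM; congr EFin.
  by rewrite exprNn -signr_odd nodd expr1.
Qed.

Lemma supported_in_le {R : realType} (mu : probability (measurableTypeR R) R) (L L' : R) :
  L <= L' -> supported_in mu L -> supported_in mu L'.
Proof.
move=> LL mL; apply: subset_measure0 mL.
- by apply: measurableC; exact: measurable_segment.
- by apply: measurableC; exact: measurable_segment.
- apply: subsetC => x; rewrite /= !in_itv /= -!ler_norml.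
  by move=> xL; exact: le_trans LL.
Qed.


(** * From log-potentials to entropy powers *)

Section EntropyPower.
Context {R : realType}.
Implicit Types mu : probability (measurableTypeR R) R.

Lemma expeR_entropy_le0 mu :
  (expeR (2%:E * boolean_entropy mu) <= 0)%E -> boolean_entropy mu = -oo%E.
Proof.
move=> h; have : expeR (2%:E * boolean_entropy mu)%E == 0%E.
  by rewrite eq_le h expeR_ge0.
rewrite expeR_eq0; case: (boolean_entropy mu) => [r||] //.
by rewrite gt0_muley ?lte_fin.
Qed.

(** For [X] and [Y] it suffices that the entropy lies below each log-potential. Only the right-hand
    side needs a limit, taken on logarithms, where convergence in the extended reals is known. *)
Lemma log_potential_entropy_power muX muY muXY (L : R) :
  supported_in muX L -> supported_in muY L -> supported_in muXY L ->
  (forall s, 0 < s ->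
    expR (log_potential muX L s) + expR (log_potential muY L s) - s
      <= expR (log_potential muXY L s)) ->
  (expeR (2%:E * boolean_entropy muX) + expeR (2%:E * boolean_entropy muY)
    <= expeR (2%:E * boolean_entropy muXY))%E.
Proof.
move=> sX sY sXY ineq.
have key n : expR (log_potential muX L (harmonic n)) +
    expR (log_potential muY L (harmonic n)) - harmonic n
    <= expR (log_potential muXY L (harmonic n)).
  by apply: ineq; rewrite /harmonic /= invr_gt0.
set k := (_ + _)%E.
have k_le n : (k <= (expR (log_potential muXY L (harmonic n)) + harmonic n)%:E)%E.
  apply: (@le_trans _ _ (expR (log_potential muX L (harmonic n)) +
    expR (log_potential muY L (harmonic n)))%:E); last by rewrite lee_fin -lerBlDr.
  rewrite EFinD; apply: leeD; rewrite -[leRHS]/(expeR (_%:E)) lee_expeR.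
    exact: boolean_entropy_le_log_potential.
  exact: boolean_entropy_le_log_potential.
have k0 : (0 <= k)%E by rewrite adde_ge0 ?expeR_ge0.
apply/lee_addgt0Pr => e e0.
have kfin : k \is a fin_num.
  by rewrite ge0_fin_numE//; apply: le_lt_trans (k_le 0%N) (ltry _).
(* The logarithm of [fine k - e] is usable only if this is positive; otherwise the bound is
   trivial. *)
have [ke|ek] := leP (fine k) e.
  rewrite -[k]fineK// (le_trans (_ : _ <= e%:E)%E) ?lee_fin//.
  by rewrite leeDr// expeR_ge0.
have ke0 : 0 < fine k - e by rewrite subr_gt0.
have lnk : ((ln (fine k - e))%:E <= 2%:E * boolean_entropy muXY)%E.
  have near_e : \forall n \near \oo, harmonic n <= e :> R.
    have /cvgrPdist_le /(_ e e0) := @cvg_harmonic R; apply: filterS => n.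
    by rewrite sub0r normrN ger0_norm// /harmonic /= invr_ge0.
  apply: (cvge_to_ge (log_potential_cvg sXY)); near=> n.
  rewrite lee_fin -ler_expR lnK ?posrE//.
  have ne : harmonic n <= e :> R by near: n; exact: near_e.
  have := k_le n; rewrite -[k in (k <= _)%E]fineK// lee_fin => kn.
  by move: kn ne; lra.
rewrite -leeBlDr// -[k]fineK// -EFinB -[(fine k - e)]lnK ?posrE//.
by rewrite -[leLHS]/(expeR (_%:E)) lee_expeR.
Unshelve. all: by end_near. Qed.

End EntropyPower.

(** * The inequality for Boolean independent operators *)

Local Open Scope complex_scope.

Lemma boolean_sum_log_potential (R : realType) (H : completeNormedModType R[i])
    (ip : {dot H for Num.conj}) (M : set (H -> H)) (tau : (H -> H) -> R[i])
    (HM : nc_probability_space ip M tau)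
    (X Y : H -> H)
    (MX : M X) (MY : M Y)
    (saX : selfadjoint ip X) (saY : selfadjoint ip Y)
    (muX muY muXY : probability (measurableTypeR R) R) :
  is_law tau X muX -> is_law tau Y muY -> is_law tau (fun x => X x + Y x) muXY ->
  symmetric_law muX -> symmetric_law muY -> boolean_independent tau X Y ->
  exists L : R, [/\ supported_in muX L, supported_in muY L, supported_in muXY L &
    forall s, 0 < s ->
      expR (log_potential muX L s) + expR (log_potential muY L s) - s
        <= expR (log_potential muXY L s)].
Proof.
move=> lawX lawY lawXY symX symY indep.
have [_ [_ vnM] st _ _] := HM.
have MXY : M (fun x => X x + Y x) by exact: vn_add.
have saXY : selfadjoint ip (fun x => X x + Y x).
  move=> x y; rewrite linearDl linearDr; congr (_ + _); [exact: saX|exact: saY].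
have supp (A : H -> H) (mu : probability (measurableTypeR R) R) :
    M A -> selfadjoint ip A -> is_law tau A mu ->
    exists2 L, 0 < L & supported_in mu L.
  move=> MA sA lA; have [L L0 hL] := even_moment_le HM MA sA lA.
  exists (L + 1); first by rewrite ltr_wpDl.
  by apply: even_moments_supported => // k; have [] := lA k.
have [L1 L10 sX] := supp _ _ MX saX lawX.
have [L2 L20 sY] := supp _ _ MY saY lawY.
have [L3 L30 sXY] := supp _ _ MXY saXY lawXY.
(* One segment common to the three laws. *)
pose L := L1 + L2 + L3.
have L0 : 0 < L by rewrite !addr_gt0.
have {}sX : supported_in muX L by apply: supported_in_le sX; rewrite /L; lra.
have {}sY : supported_in muY L by apply: supported_in_le sY; rewrite /L; lra.
have {}sXY : supported_in muXY L by apply: supported_in_le sXY; rewrite /L; lra.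
have mD (mu : probability (measurableTypeR R) R) A n : supported_in mu L ->
    is_law tau A mu -> \int[mu]_x (x ^+ n) = \int[mu]_(x in `[- L, L]) (x ^+ n).
  by move=> mL lA; apply: integral_segment => //; have [] := lA n.
have odd0 (mu : probability (measurableTypeR R) R) A : supported_in mu L ->
    is_law tau A mu -> symmetric_law mu ->
    forall n, odd n -> \int[mu]_(x in `[- L, L]) (x ^+ n) = 0.
  move=> mL lA smu n nodd; rewrite -(mD _ A)//.
  by apply: symmetric_odd_moment => //; have [] := lA n.
have [a [b [[a0 b0] aS bS wS]]] :=
  boolean_sum_moments vnM st MX MY indep lawX lawY lawXY.
have eqn := @stieltjes_boolean_sum R muX muY muXY L L0 sX sY sXY
  (odd0 _ _ sX lawX symX) (odd0 _ _ sY lawY symY) a b a0 b0.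
have {}eqn s : 0 < s -> stieltjes muXY L s *
    (stieltjes muX L s + stieltjes muY L s - s * (stieltjes muX L s * stieltjes muY L s))
  = stieltjes muX L s * stieltjes muY L s.
  apply: eqn => n.
  - by rewrite aS; apply: eq_bigr => k _; rewrite (mD _ X).
  - by rewrite bS; apply: eq_bigr => k _; rewrite (mD _ Y).
  - by rewrite -wS (mD _ (fun x => X x + Y x)).
exists L; split => // s; exact: log_potential_boolean_sum.
Qed.

Local Open Scope ereal_scope.

Theorem corollary1p11 (R : realType) (H : completeNormedModType R[i])
    (ip : {dot H for Num.conj}) (M : set (H -> H)) (tau : (H -> H) -> R[i])
    (HM : nc_probability_space ip M tau)
    (X Y : H -> H)
    (MX : M X) (MY : M Y)
    (saX : selfadjoint ip X) (saY : selfadjoint ip Y)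
    (muX muY muXY : probability (measurableTypeR R) R)
    (lawX : is_law tau X muX) (lawY : is_law tau Y muY)
    (lawXY : is_law tau (fun x => (X x + Y x)%R) muXY)
    (symX : symmetric_law muX) (symY : symmetric_law muY)
    (indep : boolean_independent tau X Y) :
  expeR (2%:E * boolean_entropy muX) + expeR (2%:E * boolean_entropy muY)
    <= expeR (2%:E * boolean_entropy muXY) /\
  (boolean_entropy muXY = -oo ->
     boolean_entropy muX = -oo /\ boolean_entropy muY = -oo).
Proof.
have [L [sX sY sXY ineq]] := boolean_sum_log_potential HM MX MY saX saY
  lawX lawY lawXY symX symY indep.
have main := log_potential_entropy_power sX sY sXY ineq.
(* The right-hand side is now [expeR -oo = 0], which bounds each of the two nonnegative summands. *)
split=> // eXY; move: main; rewrite eXY gt0_muleNy ?lte_fin//= => le0.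
split; apply: expeR_entropy_le0; apply: le_trans le0.
  by rewrite leeDl// expeR_ge0.
by rewrite leeDr// expeR_ge0.
Qed.
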